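(* Let $\Gamma$ be a countable residually finite discrete group and $(\Gamma_n)_{n\ge1}$ a sequence of finite index normal subgroups of $\Gamma$ with $\lim_{n\to\infty}\Gamma_n=\{1\}$. Let $\Gamma^{(n)}=\Gamma/\Gamma_n$. Then for every unit $f\in L^1(\Gamma,\mathbb{C})^*$, $$\det\nolimits_{\mathcal{N}\Gamma}f=\lim_{n\to\infty}\det\nolimits_{\mathcal{N}\Gamma^{(n)}}f^{(n)} .$$
   Context: $\lim_{n\to\infty}\Gamma_n=\{1\}$ means: for every finite $K\subset\Gamma$ there is $N\ge1$ with $\Gamma_n\cap(K^{-1}K)=\{1\}$ for all $n\ge N$ (where for $K=\varnothing$ nothing is required). For a discrete group $G$, $L^p(G,\mathbb{C})$ is the complex $L^p$-space; $L^1(G,\mathbb{C})$ is an algebra under convolution $(h\cdot h')_\gamma=\sum_{\gamma'}h_{\gamma'}h'_{\gamma'^{-1}\gamma}$ with involution $(w^* )_\gamma=\overline{w_{\gamma^{-1}}}$, and $L^1(G,\mathbb{C})^*$ is its group of units. $\mathcal{N}G$ is the von Neumann algebra of bounded operators on $L^2(G,\mathbb{C})$ commuting with all left shifts $(\lambda^\gamma v)_{\gamma'}=v_{\gamma^{-1}\gamma'}$, with trace $\operatorname{tr}_{\mathcal{N}G}(A)=\langle Ae(1),e(1)\rangle$, where $e(1)$ is the indicator function of the identity. An element $f\in L^1(G,\mathbb{C})$ is regarded as the operator $\rho_f\in\mathcal{N}G$, $\rho_f(v)=v\cdot f^*$. For invertible $A\in\mathcal{N}G$ the Fuglede–Kadison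 determinant is $\det_{\mathcal{N}G}A=\exp\left(\frac12\operatorname{tr}_{\mathcal{N}G}(\log AA^* )\right)$. For $f\in L^1(\Gamma,\mathbb{C})$, $f^{(n)}\in L^1(\Gamma^{(n)},\mathbb{C})$ is defined by $f^{(n)}(\delta)=\sum_{\gamma\in\delta}f(\gamma)$ for each residue class $\delta\in\Gamma^{(n)}$; the map $f\mapsto f^{(n)}$ is a homomorphism of algebras with involution, so $f^{(n)}$ is a unit when $f$ is. *)

(* Defs.v *)
From HB Require Import structures.
From mathcomp Require Import all_boot all_order all_algebra.
From mathcomp Require Import all_classical all_reals all_analysis.
From mathcomp Require Import complex ring lra.

Set Implicit Arguments.
Unset Strict Implicit.
Unset Printing Implicit Defensive.

Import Order.TTheory GRing.Theory Num.Theory.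
Import numFieldNormedType.Exports.

Local Open Scope classical_set_scope.
Local Open Scope complex_scope.
Local Open Scope ring_scope.

Notation cnorm := ComplexField.Normc.normc.

Record normalSubgroup (G : groupType) := NormalSubgroup {
  subgroup_of_normal :> groupClosed G;
  normalJ : forall x y : G,
    x \in subgroup_of_normal -> (x ^ y)%g \in subgroup_of_normal }.

Section quotient_group.
Variables (G : groupType) (N : normalSubgroup G).
Local Open Scope group_scope.

Definition coset_rel : rel G := fun x y => x^-1 * y \in N.

Lemma coset_rel_refl : reflexive coset_rel.
Proof. by move=> x; rewrite /coset_rel mulVg gpred1. Qed.

Lemma coset_rel_sym : symmetric coset_rel.
Proof. by move=> x y; rewrite /coset_rel -gpredV invgM invgK. Qed.

Lemma coset_rel_trans : transitive coset_rel.
Proof.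
move=> y x z; rewrite /coset_rel => xy yz.
by rewrite -(mulgVK y^-1 x^-1) invgK -mulgA gpredM.
Qed.

Canonical coset_equiv :=
  EquivRel coset_rel coset_rel_refl coset_rel_sym coset_rel_trans.

Definition quot := {eq_quot coset_equiv}%qT.
HB.instance Definition _ := Choice.on quot.
HB.instance Definition _ := EqQuotient.on quot.

Definition quot_pi (x : G) : quot := \pi_quot%qT x.
Definition quot_one : quot := quot_pi 1.
Definition quot_mul (a b : quot) : quot := quot_pi (repr a * repr b).
Definition quot_inv (a : quot) : quot := quot_pi (repr a)^-1.

Lemma quot_piP x y : reflect (quot_pi x = quot_pi y) (x^-1 * y \in N).
Proof. exact: (@eqmodP _ coset_equiv). Qed.

Lemma repr_piP x : x^-1 * repr (quot_pi x) \in N.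
Proof. by apply/quot_piP; rewrite /quot_pi reprK. Qed.

Lemma quot_piM x y : quot_pi (x * y) = quot_mul (quot_pi x) (quot_pi y).
Proof.
apply/quot_piP; rewrite invgM.
set a := repr _; set b := repr _.
have xa : x^-1 * a \in N by exact: repr_piP.
have yb : y^-1 * b \in N by exact: repr_piP.
have -> : y^-1 * x^-1 * (a * b) = ((x^-1 * a) ^ y) * (y^-1 * b).
  by rewrite /conjg !mulgA mulgK.
by rewrite gpredM// normalJ.
Qed.

Lemma quot_piV x : quot_pi x^-1 = quot_inv (quot_pi x).
Proof.
apply/quot_piP; set a := repr _.
have xa : x^-1 * a \in N by exact: repr_piP.
have -> : x^-1^-1 * a^-1 = ((x^-1 * a)^-1) ^ x^-1.
  by rewrite /conjg invgM !invgK !mulgA mulgK.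
by rewrite normalJ// gpredV.
Qed.

Lemma quot_mulA : associative quot_mul.
Proof.
move=> a b c; rewrite -(reprK a) -(reprK b) -(reprK c) -!/(quot_pi _).
by rewrite -!quot_piM mulgA.
Qed.

Lemma quot_mul1 : left_id quot_one quot_mul.
Proof.
by move=> a; rewrite -(reprK a) -!/(quot_pi _) -quot_piM mul1g.
Qed.

Lemma quot_mulg1 : right_id quot_one quot_mul.
Proof.
by move=> a; rewrite -(reprK a) -!/(quot_pi _) -quot_piM mulg1.
Qed.

Lemma quot_mulV : left_inverse quot_one quot_inv quot_mul.
Proof.
by move=> a; rewrite -(reprK a) -!/(quot_pi _) -quot_piV -quot_piM mulVg.
Qed.

Lemma quot_mulgV : right_inverse quot_one quot_inv quot_mul.
Proof.
by move=> a; rewrite -(reprK a) -!/(quot_pi _) -quot_piV -quot_piM mulgV.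
Qed.

HB.instance Definition _ := isGroup.Build quot
  quot_mulA quot_mul1 quot_mulg1 quot_mulV quot_mulgV.

End quotient_group.

Section sums.
Variables (R : realType) (T : choiceType).
Implicit Types (D : set T) (f g : T -> R[i]).

(* Sums over an arbitrary index set, as the difference of the sums of the
   positive and negative parts: these are the usual sums for absolutely
   summable families, and meaningless otherwise. *)
Definition rsum D (f : T -> R) : R :=
  fine (\esum_(x in D) (EFin \o f)^\+ x)%E -
  fine (\esum_(x in D) (EFin \o f)^\- x)%E.

Definition csum D f : R[i] :=
  rsum D (@complex.Re R \o f) +i* rsum D (@complex.Im R \o f).

Definition csummable D f := summable D (fun x => (cnorm (f x))%:E).

Lemma esumZl D (c : R) (a : T -> \bar R) : 0 <= c -> (forall x, 0 <= a x)%E ->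
  (\esum_(x in D) (c%:E * a x) = c%:E * \esum_(x in D) a x)%E.
Proof.
move=> c0 a0; rewrite /esum -ereal_supZl//; last first.
  by apply/set0P; exists (\sum_(x \in set0) a x)%E; exists set0 => //; exact: fsets_set0.
congr ereal_sup; apply/seteqP; split=> [_ [A AD <-]|_ [_ [A AD <-] <-]].
  by exists (\sum_(x \in A) a x)%E; [exists A|rewrite ge0_mule_fsumr].
by exists A => //; rewrite ge0_mule_fsumr.
Qed.

Lemma summable_le D (f g : T -> R) :
  (forall x, D x -> `|f x| <= `|g x|) ->
  summable D (EFin \o g) -> summable D (EFin \o f).
Proof.
by move=> fg; apply: le_lt_trans; apply: le_esum => x Dx; rewrite /= lee_fin fg.
Qed.

Lemma summable_ge0 D (f : T -> R) : (forall x, 0 <= f x) ->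
  summable D (EFin \o f) <-> (\esum_(x in D) (f x)%:E < +oo)%E.
Proof.
by move=> f0; rewrite /summable (eq_esum (b := EFin \o f))// => x _ /=; rewrite ger0_norm.
Qed.

Lemma esum_fineK D (f : T -> R) : (forall x, 0 <= f x) -> summable D (EFin \o f) ->
  (fine (\esum_(x in D) (f x)%:E))%:E = (\esum_(x in D) (f x)%:E)%E.
Proof.
move=> f0 /(summable_ge0 _ f0) sf; rewrite fineK// ge0_fin_numE//.
by apply: esum_ge0 => x _; rewrite lee_fin.
Qed.

Lemma rsumB D (p q : T -> R) : (forall x, 0 <= p x) -> (forall x, 0 <= q x) ->
  summable D (EFin \o p) -> summable D (EFin \o q) ->
  rsum D (p \- q) =
  fine (\esum_(x in D) (p x)%:E)%E - fine (\esum_(x in D) (q x)%:E)%E.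
Proof.
move=> p0 q0 sp sq.
have spq : summable D ((EFin \o p) \- (EFin \o q))%E by exact: summableB.
have := esumB sp sq (fun x _ => p0 x) (fun x _ => q0 x).
have finp (h : T -> \bar R) : summable D h -> (forall x, 0 <= h x)%E ->
    (\esum_(x in D) h x)%E \is a fin_num.
  move=> sh h0; rewrite (eq_esum (b := abse \o h)); first by rewrite -summableE.
  by move=> x _ /=; rewrite gee0_abs.
move=> /(congr1 fine); rewrite !fineB//; apply: finp => //.
- exact: summable_funepos.
- exact: summable_funeneg.
Qed.

Lemma rsum_ge0 D (f : T -> R) : (forall x, 0 <= f x) -> summable D (EFin \o f) ->
  rsum D f = fine (\esum_(x in D) (f x)%:E)%E.
Proof.
move=> f0 sf; rewrite -[RHS]subr0 -[0 in RHS]/(fine 0%:E).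
have -> : 0%:E = (\esum_(x in D) ((fun=> 0 : R) x)%:E)%E by rewrite esum1.
rewrite -rsumB//; first by congr rsum; apply/funext => x /=; rewrite subr0.
by apply/summable_ge0 => //; rewrite esum1.
Qed.

Let pos (f : T -> R) x := Num.max (f x) 0.
Let neg (f : T -> R) x := Num.max (- f x) 0.

Let posneg (f : T -> R) x : f x = pos f x - neg f x.
Proof. by rewrite /pos /neg; case: (leP (f x) 0); case: (leP (- f x) 0) => ? ?; lra. Qed.

Let pos_ge0 (f : T -> R) x : 0 <= pos f x. Proof. by rewrite le_max lexx orbT. Qed.
Let neg_ge0 (f : T -> R) x : 0 <= neg f x. Proof. by rewrite le_max lexx orbT. Qed.

Let pos_le (f : T -> R) x : `|pos f x| <= `|f x|.
Proof. by rewrite ger0_norm// ge_max ler_norm normr_ge0. Qed.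
Let neg_le (f : T -> R) x : `|neg f x| <= `|f x|.
Proof. by rewrite ger0_norm// ge_max -normrN ler_norm normr_ge0. Qed.

Let spos D (f : T -> R) : summable D (EFin \o f) -> summable D (EFin \o pos f).
Proof. by apply: summable_le => x _; exact: pos_le. Qed.
Let sneg D (f : T -> R) : summable D (EFin \o f) -> summable D (EFin \o neg f).
Proof. by apply: summable_le => x _; exact: neg_le. Qed.

Lemma summableRD D (f g : T -> R) : summable D (EFin \o f) ->
  summable D (EFin \o g) -> summable D (EFin \o (f \+ g)).
Proof. exact: summableD. Qed.

Lemma fine_esumD D (f g : T -> R) : (forall x, 0 <= f x) -> (forall x, 0 <= g x) ->
  summable D (EFin \o f) -> summable D (EFin \o g) ->
  fine (\esum_(x in D) ((f \+ g) x)%:E)%E =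
  fine (\esum_(x in D) (f x)%:E)%E + fine (\esum_(x in D) (g x)%:E)%E.
Proof.
move=> f0 g0 sf sg; apply: EFin_inj; rewrite EFinD !esum_fineK//.
- by rewrite -esumD// => x _; rewrite lee_fin.
- by move=> x; rewrite addr_ge0.
- exact: summableRD.
Qed.

Let rsumE D (f : T -> R) : summable D (EFin \o f) ->
  rsum D f = fine (\esum_(x in D) (pos f x)%:E)%E -
             fine (\esum_(x in D) (neg f x)%:E)%E.
Proof.
move=> sf; rewrite -rsumB//; [|exact: spos|exact: sneg].
by congr rsum; apply/funext => x; rewrite [LHS]posneg.
Qed.

Lemma rsumD D (f g : T -> R) : summable D (EFin \o f) ->
  summable D (EFin \o g) -> rsum D (f \+ g) = rsum D f + rsum D g.
Proof.
move=> sf sg.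
have -> : f \+ g = (pos f \+ pos g) \- (neg f \+ neg g).
  by apply/funext => x /=; rewrite (posneg f) (posneg g); ring.
have pf := spos sf; have nf := sneg sf; have pg := spos sg; have ng := sneg sg.
have p0 x : 0 <= (pos f \+ pos g) x by rewrite /= addr_ge0.
have n0 x : 0 <= (neg f \+ neg g) x by rewrite /= addr_ge0.
rewrite (rsumE sf) (rsumE sg) (rsumB p0 n0 (summableRD pf pg) (summableRD nf ng)).
rewrite (fine_esumD _ _ pf pg)// (fine_esumD _ _ nf ng)//.
by rewrite opprD addrACA.
Qed.

Lemma summableRZ D (c : R) (f : T -> R) : summable D (EFin \o f) ->
  summable D (EFin \o (fun x => c * f x)).
Proof.
rewrite /summable => sf; rewrite (eq_esum (b := fun x => (`|c|%:E * `|(f x)%:E|)%E)).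
  by rewrite esumZl//; exact: lte_mul_pinfty.
by move=> x _ /=; rewrite normrM.
Qed.

Lemma rsumN D (f : T -> R) : summable D (EFin \o f) ->
  rsum D (fun x => - f x) = - rsum D f.
Proof.
move=> sf; rewrite (rsumE sf).
have -> : (fun x => - f x) = neg f \- pos f.
  by apply/funext => x /=; rewrite (posneg f) opprB.
by rewrite rsumB ?opprB//; [exact: sneg|exact: spos].
Qed.

Lemma rsumZ D (c : R) (f : T -> R) : summable D (EFin \o f) ->
  rsum D (fun x => c * f x) = c * rsum D f.
Proof.
have key (d : R) : 0 <= d -> summable D (EFin \o f) ->
    rsum D (fun x => d * f x) = d * rsum D f.
  move=> d0 sf; rewrite (rsumE sf).
  have -> : (fun x => d * f x) = (fun x => d * pos f x) \- (fun x => d * neg f x).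
    by apply/funext => x /=; rewrite (posneg f) mulrBr.
  rewrite rsumB.
  - have := esumZl D d0 (fun x => pos_ge0 f x : 0 <= (pos f x)%:E)%E => /= ->.
    have := esumZl D d0 (fun x => neg_ge0 f x : 0 <= (neg f x)%:E)%E => /= ->.
    rewrite mulrBr -(esum_fineK (pos_ge0 f) (spos sf)).
    by rewrite -(esum_fineK (neg_ge0 f) (sneg sf)).
  - by move=> x; rewrite mulr_ge0.
  - by move=> x; rewrite mulr_ge0.
  - exact/summableRZ/spos.
  - exact/summableRZ/sneg.
case: (leP 0 c) => [c0|c0 sf]; first exact: key.
have -> : (fun x => c * f x) = (fun x => - (- c * f x)).
  by apply/funext => x; rewrite mulNr opprK.
rewrite rsumN; last exact: summableRZ.
by rewrite key ?mulNr ?opprK// oppr_ge0 ltW.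
Qed.

Lemma rsum_le D (f : T -> R) : summable D (EFin \o f) ->
  `|rsum D f| <= fine (\esum_(x in D) `|f x|%:E)%E.
Proof.
move=> sf; rewrite (rsumE sf).
have -> : (fun x => `|f x|%:E) = (fun x => ((pos f \+ neg f) x)%:E).
  apply/funext => x /=; congr EFin; rewrite /pos /neg.
  by case: (leP (f x) 0) => fx; case: (leP (- f x) 0) => ?; rewrite ?(ler0_norm fx) ?(gtr0_norm fx); lra.
have sp := spos sf; have sn := sneg sf.
rewrite fine_esumD//.
have p0 : 0 <= fine (\esum_(x in D) (pos f x)%:E)%E.
  by rewrite fine_ge0// esum_ge0// => x _; rewrite lee_fin.
have n0 : 0 <= fine (\esum_(x in D) (neg f x)%:E)%E.
  by rewrite fine_ge0// esum_ge0// => x _; rewrite lee_fin.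
by rewrite ler_norml; lra.
Qed.

Lemma reim_le (z : R[i]) :
  [/\ `|complex.Re z| <= cnorm z, `|complex.Im z| <= cnorm z &
      cnorm z <= `|complex.Re z| + `|complex.Im z|].
Proof.
case: z => a b /=; split.
- by rewrite -sqrtr_sqr ler_sqrt ?addr_ge0 ?sqr_ge0// lerDl sqr_ge0.
- by rewrite -sqrtr_sqr ler_sqrt ?addr_ge0 ?sqr_ge0// lerDr sqr_ge0.
- have h : 0 <= `|a| + `|b| by rewrite addr_ge0.
  rewrite -(ger0_norm h) -sqrtr_sqr ler_sqrt ?sqr_ge0//.
  rewrite sqrrD !real_normK ?num_real// addrAC lerDl.
  by rewrite mulrn_wge0// mulr_ge0.
Qed.

Lemma csummable_re D f : csummable D f -> summable D (EFin \o (@complex.Re R \o f)).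
Proof.
apply: summable_le => x _ /=; apply: le_trans (ler_norm _).
by case: (reim_le (f x)).
Qed.

Lemma csummable_im D f : csummable D f -> summable D (EFin \o (@complex.Im R \o f)).
Proof.
apply: summable_le => x _ /=; apply: le_trans (ler_norm _).
by case: (reim_le (f x)).
Qed.

Lemma cnorm_ge0 (z : R[i]) : 0 <= cnorm z.
Proof. by case: z => a b; rewrite sqrtr_ge0. Qed.

Lemma csummable_le D f g : (forall x, cnorm (f x) <= cnorm (g x)) ->
  csummable D g -> csummable D f.
Proof. by move=> fg; apply: summable_le => x _; rewrite !ger0_norm ?cnorm_ge0. Qed.

Lemma csummableD D f g : csummable D f -> csummable D g -> csummable D (f \+ g).
Proof.
move=> sf sg; apply: summable_le (summableRD sf sg) => x _ /=.
by rewrite !ger0_norm ?addr_ge0 ?cnorm_ge0// le_normcD.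
Qed.

Lemma csummableZ D c f : csummable D f -> csummable D (fun x => c * f x).
Proof.
move=> sf; apply: summable_le (summableRZ (cnorm c) sf) => x _ /=.
by rewrite ComplexField.Normc.normcM.
Qed.

Lemma csumD D f g : csummable D f -> csummable D g ->
  csum D (f \+ g) = csum D f + csum D g.
Proof.
move=> sf sg; rewrite /csum.
have -> : @complex.Re R \o (f \+ g) = (@complex.Re R \o f) \+ (@complex.Re R \o g).
  by apply/funext => x /=; case: (f x) (g x) => ? ? [].
have -> : @complex.Im R \o (f \+ g) = (@complex.Im R \o f) \+ (@complex.Im R \o g).
  by apply/funext => x /=; case: (f x) (g x) => ? ? [].
by rewrite (rsumD (csummable_re sf) (csummable_re sg)) (rsumD (csummable_im sf) (csummable_im sg)).
Qed.

Lemma csumZ D c f : csummable D f -> csum D (fun x => c * f x) = c * csum D f.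
Proof.
move=> sf; rewrite /csum; case: c => a b.
have sr := csummable_re sf; have si := csummable_im sf.
have -> : @complex.Re R \o (fun x => (a +i* b) * f x) =
    (fun x => a * (@complex.Re R \o f) x) \+ (fun x => - b * (@complex.Im R \o f) x).
  by apply/funext => x /=; case: (f x) => ? ? /=; rewrite mulNr.
have -> : @complex.Im R \o (fun x => (a +i* b) * f x) =
    (fun x => a * (@complex.Im R \o f) x) \+ (fun x => b * (@complex.Re R \o f) x).
  by apply/funext => x /=; case: (f x).
rewrite (rsumD (summableRZ a sr) (summableRZ (- b) si)).
rewrite (rsumD (summableRZ a si) (summableRZ b sr)).
rewrite (rsumZ a sr) (rsumZ (- b) si) (rsumZ a si) (rsumZ b sr) mulNr.
by [].
Qed.

Lemma cnorm_csum D f : csummable D f ->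
  cnorm (csum D f) <= 2 * fine (\esum_(x in D) (cnorm (f x))%:E)%E.
Proof.
move=> sf; have sr := csummable_re sf; have si := csummable_im sf.
case: (reim_le (csum D f)) => _ _ /le_trans; apply.
have key (h : T -> R) : (forall x, `|h x| <= cnorm (f x)) ->
    summable D (EFin \o h) ->
    `|rsum D h| <= fine (\esum_(x in D) (cnorm (f x))%:E)%E.
  move=> hf sh; apply: le_trans (rsum_le sh) _.
  have sh' : summable D (EFin \o (fun x => `|h x|)).
    by apply: summable_le sh => x _ /=; rewrite normr_id.
  have f0 x : 0 <= cnorm (f x) by exact: cnorm_ge0.
  rewrite -lee_fin (esum_fineK _ sh')// (esum_fineK f0 sf).
  by apply: le_esum => x _; rewrite lee_fin.
rewrite mulr_natl mulr2n /=; apply: lerD.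
- by apply: (key _ _ sr) => x; case: (reim_le (f x)).
- by apply: (key _ _ si) => x; case: (reim_le (f x)).
Qed.

End sums.

Lemma csum_reindex (R : realType) (T T' : choiceType) (h : T' -> T) (f : T -> R[i]) :
  bijective h -> csum [set: T] f = csum [set: T'] (f \o h).
Proof.
rewrite -setTT_bijective => hb.
have E (u : T -> R) : rsum [set: T] u = rsum [set: T'] (u \o h).
  rewrite /rsum !(reindex_esum _ _ _ _ hb); congr (fine _ - fine _).
    by apply: eq_esum => x _; rewrite !funeposE.
  by apply: eq_esum => x _; rewrite !funenegE.
by rewrite /csum !E.
Qed.

Section lp.
Variables (R : realType) (T : choiceType).

Definition Lp (p : nat) (f : T -> R[i]) : Prop :=
  (\esum_(x in [set: T]) (cnorm (f x) ^+ p)%:E < +oo)%E.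

Record L1 := MkL1 { L1val :> T -> R[i]; L1P : Lp 1 L1val }.

Definition L2_pred : {pred T -> R[i]} := [pred f | `[< Lp 2 f >]].

Record L2 := MkL2 { L2val :> T -> R[i]; _ : L2val \in L2_pred }.
HB.instance Definition _ := [isSub for L2val].
HB.instance Definition _ := [Choice of L2 by <:].

Lemma L2P (v : L2) : Lp 2 v.
Proof. exact/asboolP/(valP v). Qed.

Lemma Lp1E f : Lp 1 f <-> csummable [set: T] f.
Proof. by rewrite /csummable summable_ge0// => x; exact: cnorm_ge0. Qed.

Lemma Lp2E f : Lp 2 f <-> summable [set: T] (EFin \o (fun x => cnorm (f x) ^+ 2)).
Proof. by rewrite /Lp summable_ge0// => x; rewrite sqr_ge0. Qed.

Lemma L2_submod_closed : submod_closed L2_pred.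
Proof.
split.
  apply/asboolP; rewrite /Lp esum1// => x _.
  have -> : cnorm ((0 : T -> R[i]) x) = 0 by exact: ComplexField.Normc.normc0.
  by rewrite expr0n.
move=> c f g /asboolP/Lp2E sf /asboolP/Lp2E sg; apply/asboolP/Lp2E.
have := summableRD (summableRZ (2 * cnorm c ^+ 2) sf) (summableRZ 2 sg).
apply: summable_le => x _ /=.
have c0 : 0 <= cnorm c by exact: cnorm_ge0.
rewrite ger0_norm ?sqr_ge0// ger0_norm; last by rewrite addr_ge0// mulr_ge0// ?sqr_ge0// mulr_ge0// sqr_ge0.
have : cnorm (c * f x + g x) <= cnorm c * cnorm (f x) + cnorm (g x).
  by rewrite -ComplexField.Normc.normcM le_normcD.
have := cnorm_ge0 (c * f x + g x).
set u := cnorm (c * f x + g x); set a := cnorm c * _; set b := cnorm (g x) => u0 uab.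
rewrite -mulrA -exprMn -/a.
apply: (@le_trans _ _ ((a + b) ^+ 2)).
  by rewrite ler_pXn2r// nnegrE// (le_trans u0).
by have := sqr_ge0 (a - b); rewrite sqrrB sqrrD; lra.
Qed.

HB.instance Definition _ := GRing.isSubmodClosed.Build R[i] (T -> R[i]) L2_pred L2_submod_closed.
HB.instance Definition _ := [SubChoice_isSubLmodule of L2 by <:].

Definition l2norm (v : L2) : R :=
  Num.sqrt (fine (\esum_(x in [set: T]) (cnorm (v x) ^+ 2)%:E)).

Definition inner (v w : L2) : R[i] := csum [set: T] (fun x => v x * (w x)^*%C).

End lp.

Section convolution.
Variables (R : realType) (G : groupType).
Implicit Types (a b : G -> R).

Definition convol (h h' : G -> R[i]) : G -> R[i] := fun g =>
  csum [set: G] (fun g' => h g' * h' (g'^-1 * g)%g).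

Definition l1_star (w : G -> R[i]) : G -> R[i] := fun g => (w (g^-1)%g)^*%C.

Definition dirac1 : G -> R[i] := fun g => (g == 1%g)%:R.

Lemma bij_mull (g : G) : bijective (fun x => g * x)%g.
Proof. by exists (fun x => g^-1 * x)%g => x; rewrite ?mulKg ?mulVKg. Qed.

Lemma bij_invMr (g : G) : bijective (fun x => x^-1 * g)%g.
Proof.
exists (fun x => g * x^-1)%g => x; rewrite ?invgM ?invgK ?mulKg ?mulVKg//.
by rewrite -mulgA mulVg mulg1.
Qed.

Lemma esum_bij (T T' : choiceType) (h : T' -> T) (u : T -> \bar R) :
  bijective h ->
  (\esum_(x in [set: T]) u x = \esum_(x in [set: T']) u (h x))%E.
Proof. by rewrite -setTT_bijective => hb; exact: reindex_esum. Qed.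

Lemma esum_swap (T : choiceType) (u : T -> T -> \bar R) :
  (forall x y, (0 <= u x y)%E) ->
  (\esum_(x in [set: T]) \esum_(y in [set: T]) u x y =
   \esum_(y in [set: T]) \esum_(x in [set: T]) u x y)%E.
Proof.
move=> u0; rewrite esum_esum// [RHS]esum_esum//=.
set P := (X in esum X _ = _); set Q := (X in _ = esum X _).
have hb : set_bij Q P (fun p : T * T => (p.2, p.1)).
  by split=> [[x y]//|[x y] [z t] _ _ [-> ->]//|[x y] _]; exists (y, x).
by rewrite (reindex_esum _ _ _ _ hb).
Qed.

Lemma esum_pointwise (T : choiceType) (b : T -> R) x : (forall x, 0 <= b x) ->
  ((b x)%:E <= \esum_(x in [set: T]) (b x)%:E)%E.
Proof.
move=> b0; apply: esum_ge; exists [set x]; first by split.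
by rewrite fsbig_set1.
Qed.

Lemma summable_prod a b g : (forall x, 0 <= a x) -> (forall x, 0 <= b x) ->
  summable [set: G] (EFin \o (fun x => a x ^+ 2)) ->
  summable [set: G] (EFin \o b) ->
  summable [set: G] (EFin \o (fun x => a x * b (x^-1 * g)%g)).
Proof.
move=> a0 b0 sa sb.
pose B := fine (\esum_(x in [set: G]) (b x)%:E)%E.
have bB x : b x <= B by rewrite -lee_fin (esum_fineK b0 sb) esum_pointwise.
have sb' : summable [set: G] (EFin \o (fun x => b (x^-1 * g)%g)).
  apply/summable_ge0 => //; rewrite -(esum_bij (fun x => (b x)%:E) (bij_invMr g)).
  exact/summable_ge0.
apply: summable_le (summableRD sa (summableRZ B sb')) => x _ /=.
have B0 : 0 <= B by exact: le_trans (b0 g) (bB g).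
have bx := b0 (x^-1 * g)%g; have bBx := bB (x^-1 * g)%g; have ax := a0 x.
rewrite !ger0_norm ?mulr_ge0// ?addr_ge0 ?mulr_ge0 ?sqr_ge0//.
set u := a x; set w := b _.
have := sqr_ge0 (u - w); have := ler_pM bx bx bBx (lexx w); rewrite sqrrB -expr2 -/w.
have := mulr_ge0 ax bx; rewrite -/u -/w; lra.
Qed.

Lemma young_pointwise a b g (B : R) : (forall x, 0 <= a x) -> (forall x, 0 <= b x) ->
  (\esum_(x in [set: G]) (b x)%:E <= B%:E)%E -> 0 < B ->
  summable [set: G] (EFin \o (fun x => a x ^+ 2)) ->
  summable [set: G] (EFin \o b) ->
  ((fine (\esum_(x in [set: G]) (a x * b (x^-1 * g)%g)%:E) ^+ 2)%:E <=
   B%:E * \esum_(x in [set: G]) (a x ^+ 2 * b (x^-1 * g)%g)%:E)%E.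
Proof.
move=> a0 b0 bB B0 sa sb.
have sab := summable_prod g a0 b0 sa sb.
have ab0 x : 0 <= a x * b (x^-1 * g)%g by rewrite mulr_ge0.
set S := fine _.
have S0 : 0 <= S by rewrite fine_ge0// esum_ge0// => x _; rewrite lee_fin.
have SE : S%:E = (\esum_(x in [set: G]) (a x * b (x^-1 * g)%g)%:E)%E.
  exact: esum_fineK.
set Q := (\esum_(x in _) (a x ^+ 2 * _)%:E)%E.
pose t := S / B.
have t0 : 0 <= t by rewrite divr_ge0// ltW.
have tt : 0 <= 2 * t by rewrite mulr_ge0.
have bg0 x : (0 <= (b (x^-1 * g)%g)%:E)%E by rewrite lee_fin.
have abg0 x : (0 <= (a x * b (x^-1 * g)%g)%:E)%E by rewrite lee_fin.
have h : ((2 * t * S)%:E <= Q + (t ^+ 2 * B)%:E)%E.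
  rewrite EFinM SE -(esumZl _ tt abg0).
  apply: (@le_trans _ _ (Q + \esum_(x in [set: G]) ((t ^+ 2)%:E * (b (x^-1 * g)%g)%:E))%E).
    rewrite -esumD.
    - apply: le_esum => x _; rewrite -!EFinM -EFinD lee_fin.
      have : 0 <= (a x - t) ^+ 2 * b (x^-1 * g)%g by rewrite mulr_ge0 ?sqr_ge0.
      by rewrite sqrrB; lra.
    - by move=> x _; rewrite lee_fin mulr_ge0 ?sqr_ge0.
    - by move=> x _; rewrite -EFinM lee_fin mulr_ge0 ?sqr_ge0.
  rewrite (esumZl _ (sqr_ge0 t) bg0) leeD2l//.
  rewrite EFinM lee_wpmul2l ?lee_fin ?sqr_ge0//.
  by rewrite -(esum_bij (fun x => (b x)%:E) (bij_invMr g)).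
rewrite -leeBlDr// -EFinB in h.
have -> : (S ^+ 2)%:E = (B%:E * (2 * t * S - t ^+ 2 * B)%:E)%E.
  rewrite -EFinM; congr EFin; rewrite /t; field.
  by rewrite gt_eqF.
by rewrite lee_pmul2l.
Qed.

Lemma convol_summable (v w : G -> R[i]) g : Lp 2 v -> Lp 1 w ->
  csummable [set: G] (fun x => v x * w (x^-1 * g)%g).
Proof.
move=> /Lp2E sv /Lp1E sw.
have v0 x : 0 <= cnorm (v x) by exact: cnorm_ge0.
have w0 x : 0 <= cnorm (w x) by exact: cnorm_ge0.
have := summable_prod g v0 w0 sv sw; apply: summable_le => x _.
by rewrite /= ComplexField.Normc.normcM.
Qed.

Lemma convol_Lp2_bound (w : G -> R[i]) : Lp 1 w -> exists2 M : R, 0 <= M &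
  forall v, Lp 2 v ->
  (\esum_(g in [set: G]) (cnorm (convol v w g) ^+ 2)%:E <=
   (M ^+ 2)%:E * \esum_(g in [set: G]) (cnorm (v g) ^+ 2)%:E)%E.
Proof.
move=> sw; have sw1 := (Lp1E w).1 sw.
have w0 x : 0 <= cnorm (w x) by exact: cnorm_ge0.
pose B := fine (\esum_(x in [set: G]) (cnorm (w x))%:E)%E + 1.
have Bge : (\esum_(x in [set: G]) (cnorm (w x))%:E <= B%:E)%E.
  by rewrite -(esum_fineK w0 sw1) lee_fin lerDl.
have B0 : 0 < B.
  by rewrite ltr_wpDl// fine_ge0// esum_ge0// => x _; rewrite lee_fin.
exists (2 * B); first by rewrite mulr_ge0// ltW.
move=> v sv; have sv2 := (Lp2E v).1 sv.
have v0 x : 0 <= cnorm (v x) by exact: cnorm_ge0.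
have u0 x g : (0 <= (cnorm (v x) ^+ 2 * cnorm (w (x^-1 * g)%g))%:E)%E.
  by rewrite lee_fin mulr_ge0 ?sqr_ge0.
apply: (@le_trans _ _ (\esum_(g in [set: G]) ((4 * B)%:E *
    \esum_(x in [set: G]) (cnorm (v x) ^+ 2 * cnorm (w (x^-1 * g)%g))%:E))%E).
  apply: le_esum => g _.
  have := young_pointwise g v0 w0 Bge B0 sv2 sw1; set S := fine _ => SQ.
  have S0 : 0 <= S.
    by rewrite fine_ge0// esum_ge0// => x _; rewrite lee_fin mulr_ge0.
  have cS : cnorm (convol v w g) <= 2 * S.
    apply: le_trans (cnorm_csum (convol_summable g sv sw)) _.
    rewrite le_eqVlt; apply/orP; left; apply/eqP; congr (_ * fine _).
    by apply: eq_esum => x _; rewrite ComplexField.Normc.normcM.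
  rewrite EFinM -muleA; apply: (@le_trans _ _ (4 * S ^+ 2)%:E).
    rewrite lee_fin; have -> : 4 * S ^+ 2 = (2 * S) ^+ 2 by ring.
    by rewrite ler_pXn2r// nnegrE ?cnorm_ge0// mulr_ge0.
  by rewrite EFinM lee_wpmul2l// lee_fin.
have B4 : 0 <= 4 * B by rewrite mulr_ge0// ltW.
rewrite (esumZl _ B4); last by move=> g; exact: esum_ge0.
have -> : ((2 * B) ^+ 2)%:E = ((4 * B)%:E * B%:E)%E by rewrite -EFinM; congr EFin; ring.
rewrite -muleA lee_wpmul2l ?lee_fin// (esum_swap (fun g x => u0 x g)).
rewrite -(esumZl _ (ltW B0)); last by move=> x; rewrite lee_fin sqr_ge0.
apply: le_esum => x _.
under eq_esum do rewrite EFinM.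
rewrite (esumZl _ (sqr_ge0 _)); last by move=> g; rewrite lee_fin.
rewrite muleC lee_wpmul2r ?lee_fin ?sqr_ge0//.
by rewrite -(esum_bij (fun g => (cnorm (w g))%:E) (bij_mull x^-1)%g).
Qed.

Lemma convol_Lp2 (v w : G -> R[i]) : Lp 2 v -> Lp 1 w -> Lp 2 (convol v w).
Proof.
move=> sv sw; have [M M0 h] := convol_Lp2_bound sw.
apply: le_lt_trans (h v sv) _; apply: lte_mul_pinfty => //.
by rewrite lee_fin sqr_ge0.
Qed.

Lemma l1_star_Lp1 (w : G -> R[i]) : Lp 1 w -> Lp 1 (l1_star w).
Proof.
rewrite /Lp (esum_bij (fun g => (cnorm (w g) ^+ 1)%:E) (bij_invMr 1%g)).
under eq_esum do rewrite mulg1.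
rewrite (eq_esum (b := fun g => (cnorm (l1_star w g) ^+ 1)%:E))// => g _.
by rewrite /l1_star; case: (w _) => x y /=; rewrite sqrrN.
Qed.

Lemma dirac1_Lp2 : Lp 2 dirac1.
Proof.
rewrite /Lp (_ : esum _ _ = (\esum_(g in [set 1%g : G]) (cnorm (dirac1 g) ^+ 2)%:E)%E).
  by rewrite esum_set1 ?ltry// lee_fin sqr_ge0.
rewrite [RHS]esum_mkcond; apply: eq_esum => g _.
have [->|g1] := eqVneq g 1%g; first by rewrite mem_set.
rewrite memNset /dirac1; last by move=> /= /eqP; rewrite (negbTE g1).
by rewrite (negbTE g1) /= expr0n /= addr0 sqrtr0 expr0n.
Qed.

Lemma left_shift_Lp2 (g : G) (v : G -> R[i]) : Lp 2 v -> Lp 2 (fun x => v (g^-1 * x)%g).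
Proof. by rewrite /Lp (esum_bij _ (bij_mull g^-1%g)). Qed.

End convolution.

Lemma push_Lp1 (R : realType) (G : groupType) (N : normalSubgroup G) (f : G -> R[i]) :
  Lp 1 f -> Lp 1 (fun d : quot N => csum [set g | quot_pi N g = d] f).
Proof.
move=> sf; pose c g := (cnorm (f g))%:E.
have c0 g : (0 <= c g)%E by rewrite lee_fin cnorm_ge0.
have E : (\esum_(d in [set: quot N]) \esum_(g in [set g | quot_pi N g = d]) c g =
          \esum_(g in [set: G]) c g)%E.
  rewrite esum_esum//; set P := (X in esum X _ = _).
  have hb : set_bij P [set: G] (fun p : quot N * G => p.2).
    split=> [//|[d g] [d' g']|g _]; last by exists (quot_pi N g, g).
    by rewrite !inE /P /= => -[_ <-] [_ <-] ->.
  by rewrite [RHS](reindex_esum _ _ _ _ hb).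
apply: (@le_lt_trans _ _ (2%:E * \esum_(g in [set: G]) c g)%E); last first.
  by apply: lte_mul_pinfty => //; exact: sf.
rewrite -E -esumZl//; last by move=> d; exact: esum_ge0.
apply: le_esum => d _.
have sD : csummable [set g | quot_pi N g = d] f.
  apply: le_lt_trans ((Lp1E f).1 sf); rewrite [leLHS]esum_mkcond.
  by apply: le_esum => g _; case: ifP.
rewrite -(esum_fineK _ sD) => [|g]; last exact: cnorm_ge0.
by rewrite -EFinM lee_fin expr1 cnorm_csum.
Qed.

Section group_von_neumann_algebra.
Variables (R : realType) (G : groupType).

Definition e1 : L2 R G := MkL2 (asboolT (@dirac1_Lp2 R G)).

Definition left_shift (g : G) (v : L2 R G) : L2 R G :=
  MkL2 (asboolT (left_shift_Lp2 g (L2P v))).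

Record vN := MkVN {
  vNop :> {linear L2 R G -> L2 R G};
  vN_bounded : exists M : R, forall v, l2norm (vNop v) <= M * l2norm v;
  vN_left_shift : forall (g : G) (v : L2 R G), vNop (left_shift g v) = left_shift g (vNop v) }.

HB.instance Definition _ := gen_eqMixin vN.
HB.instance Definition _ := gen_choiceMixin vN.

Lemma vN_id_bounded : exists M : R, forall v : L2 R G, l2norm (idfun v) <= M * l2norm v.
Proof. by exists 1 => v; rewrite mul1r. Qed.

Definition vN_id : vN := @MkVN idfun vN_id_bounded (fun _ _ => erefl).

Lemma vN_comp_bounded (A B : vN) :
  exists M : R, forall v, l2norm ((A \o B) v) <= M * l2norm v.
Proof.
have [[MA hA] [MB hB]] := (vN_bounded A, vN_bounded B).
exists (`|MA| * MB) => v /=; apply: le_trans (hA _) _.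
rewrite -mulrA; apply: (@le_trans _ _ (`|MA| * l2norm (B v))).
  by rewrite ler_wpM2r ?sqrtr_ge0// ler_norm.
by rewrite ler_wpM2l.
Qed.

Lemma vN_comp_left_shift (A B : vN) g v : (A \o B) (left_shift g v) = left_shift g ((A \o B) v).
Proof. by rewrite /= !vN_left_shift. Qed.

Definition vN_comp (A B : vN) : vN :=
  @MkVN (A \o B) (vN_comp_bounded A B) (vN_comp_left_shift A B).

(* The operators below that are selected with xget are the unique ones with the
   stated property; the default value vN_id plays no role where they exist. *)
Definition vN_adj (A : vN) : vN :=
  xget vN_id [set B : vN | forall v w, inner (A v) w = inner v (B w)].

Definition vN_tr (A : vN) : R[i] := inner (A e1) e1.

Definition vN_spectrum (A : vN) : set R[i] :=
  [set z | ~ exists B : vN,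
     cancel (fun v => A v - z *: v) B /\ cancel B (fun v => A v - z *: v)].

Definition poly_op (p : {poly R}) (A : vN) (v : L2 R G) : L2 R G :=
  \sum_(i < size p) (p`_i)%:C *: iter i A v.

(* Continuous functional calculus, for A self-adjoint (so that its spectrum is
   real) and h continuous on the spectrum of A: h(A) is the limit in operator
   norm of p_n(A), for polynomials p_n converging to h uniformly on the spectrum
   of A. The limit does not depend on the choice of the p_n. *)
Definition is_funcalc (h : R -> R) (A B : vN) : Prop :=
  exists p : nat -> {poly R},
    {uniform [set x : R | vN_spectrum A x%:C],
       (fun n x => (p n).[x]) @ \oo --> h} /\
    (forall eps : R, 0 < eps -> \forall n \near \oo, forall v : L2 R G,
       l2norm (poly_op (p n) A v - B v) <= eps * l2norm v).

(* Meant for A positive and invertible, whose spectrum is a compact subset of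
   the positive half-line. *)
Definition vN_log (A : vN) : vN := xget vN_id [set B | is_funcalc (@ln R) A B].

(* Meant for A invertible. The trace of a self-adjoint operator is real. *)
Definition vN_det (A : vN) : R :=
  expR (2^-1 * complex.Re (vN_tr (vN_log (vN_comp A (vN_adj A))))).

Section rho.
Variable f : L1 R G.

Definition rho_fun (v : L2 R G) : L2 R G :=
  MkL2 (asboolT (convol_Lp2 (L2P v) (l1_star_Lp1 (L1P f)))).

Lemma rho_is_linear : linear rho_fun.
Proof.
move=> c u v; apply/val_inj/funext => g /=; rewrite /convol.
have su := convol_summable g (L2P u) (l1_star_Lp1 (L1P f)).
have sv := convol_summable g (L2P v) (l1_star_Lp1 (L1P f)).
rewrite -[RHS]/(c * csum _ _ + csum _ _) -(csumZ c su) -csumD//; last exact: csummableZ.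
by congr csum; apply/funext => x /=; rewrite mulrDl mulrA.
Qed.

HB.instance Definition _ :=
  GRing.isLinear.Build R[i] (L2 R G) (L2 R G) *:%R rho_fun rho_is_linear.

Lemma rho_bounded : exists M : R, forall v, l2norm (rho_fun v) <= M * l2norm v.
Proof.
have [M M0 h] := convol_Lp2_bound (l1_star_Lp1 (L1P f)); exists M => v.
have sv := (Lp2E _).1 (L2P v); have srv := (Lp2E _).1 (L2P (rho_fun v)).
rewrite /l2norm -[M in leRHS](ger0_norm M0) -sqrtr_sqr -sqrtrM ?sqr_ge0//.
apply: ler_wsqrtr; rewrite -lee_fin EFinM esum_fineK//; last by move=> x; exact: sqr_ge0.
by rewrite esum_fineK// => [|x]; [exact: h (L2P v)|exact: sqr_ge0].
Qed.

Lemma rho_left_shift g v : rho_fun (left_shift g v) = left_shift g (rho_fun v).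
Proof.
apply/val_inj/funext => x.
rewrite -[LHS]/(convol (left_shift g v) (l1_star f) x) -[RHS]/(convol v (l1_star f) (g^-1 * x)%g) /convol.
rewrite (csum_reindex _ (bij_mull g)); congr csum; apply/funext => y /=.
by rewrite mulKg invgM mulgA.
Qed.

Definition rho : vN := @MkVN rho_fun rho_bounded rho_left_shift.

End rho.

Definition L1_unit (f : L1 R G) : Prop :=
  exists h : L1 R G, convol f h = @dirac1 R G /\ convol h f = @dirac1 R G.

End group_von_neumann_algebra.

Definition pushL1 (R : realType) (G : groupType) (N : normalSubgroup G) (f : L1 R G) :
  L1 R (quot N) := MkL1 (push_Lp1 N (L1P f)).

Definition finite_index (G : groupType) (N : normalSubgroup G) : Prop :=
  finite_set [set: quot N].

Definition residually_finite (G : groupType) : Prop :=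
  forall g : G, g <> 1%g ->
    exists2 N : normalSubgroup G, finite_index N & g \notin N.

(* The sequence starts at n = 1: N 0 is irrelevant. *)
Definition tends_to_trivial (G : groupType) (N : nat -> normalSubgroup G) : Prop :=
  forall K : set G, finite_set K -> K !=set0 ->
    exists2 n0 : nat, (1 <= n0)%N & forall n, (n0 <= n)%N ->
      [set g | g \in N n] `&` [set (x^-1 * y)%g | x in K & y in K]
      = [set 1%g].

(* Main.v *)
From HB Require Import structures.
Require Import Defs.
From mathcomp Require Import all_boot all_order all_algebra.
From mathcomp Require Import all_classical all_reals all_analysis.
From mathcomp Require Import complex ring lra.

Set Implicit Arguments.
Unset Strict Implicit.
Unset Printing Implicit Defensive.

Import Order.TTheory GRing.Theory Num.Theory.
Import numFieldNormedType.Exports.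

Local Open Scope classical_set_scope.
Local Open Scope complex_scope.
Local Open Scope ring_scope.

(** Write [A = rho_f rho_f^*], that is [v |-> (v . f) . f^*], and [A_n] for the
    same operator of [f^(n)].  If [h] is the inverse of [f], the l1-norms of [f]
    and [h] give constants with [a |v|^2 <= <A v, v>] and [|A v| <= M |v|], and
    since the l1-norm at most doubles (because of the crude bound on complex
    sums) in a quotient, [a] and [M] can be chosen valid for all the [A_n] as
    well.  For [b = M^2 / a] this makes [1 - A/b] a contraction of norm at most
    some [d < 1], uniformly in [n], so that the polynomials
    [ln b - sum_(k < N) (1 - A_n/b)^(k+1) / (k+1)] converge to [log A_n] in
    norm, uniformly in [n].  For a fixed polynomial [p] the trace of [p(A_n)] is
    a combination of values at [1] of the pushforwards of [(f f^* )^i], that is of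
    sums of [(f f^* )^i] over [Gamma_n], which converge to its values at [1].

    As the functional calculus is only specified by polynomial approximation on
    the spectrum, one also needs [|q(A)| <= sup |q|] on the real spectrum: if
    [m = |q(A)|^2], then [m - q(A)^2] is not bounded below, hence neither is
    some linear factor [A - z], which forces [z] to be real, in the spectrum,
    and [q(z)^2 = m]. *)

(** * Exchanging absolutely convergent sums *)

Section double_sums.
Variables (R : realType) (T U : choiceType).

Lemma esum_exchange (u : T -> U -> \bar R) : (forall x y, (0 <= u x y)%E) ->
  (\esum_(x in [set: T]) \esum_(y in [set: U]) u x y =
   \esum_(y in [set: U]) \esum_(x in [set: T]) u x y)%E.
Proof.
move=> u0; rewrite esum_esum// [RHS]esum_esum//=.
set P := (X in esum X _ = _); set Q := (X in _ = esum X _).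
have hb : set_bij Q P (fun p : U * T => (p.2, p.1)).
  by split=> [[x y]//|[x y] [z t] _ _ [-> ->]//|[x y] _]; exists (y, x).
by rewrite (reindex_esum _ _ _ _ hb).
Qed.

Lemma esum_ge_term (V : choiceType) (a : V -> \bar R) x : (forall x, 0 <= a x)%E ->
  (a x <= \esum_(x in [set: V]) a x)%E.
Proof.
move=> a0; apply: esum_ge; exists [set x]; first by split.
by rewrite fsbig_set1.
Qed.

(** Absolute summability makes the inner sums of the positive and of the negative part finite, so
    the differences defining [rsum] can be regrouped. This reduces Fubini to the exchange of
    nonnegative sums. *)
Lemma rsum_rsum (h : T -> U -> R) :
  (\esum_(x in [set: T]) \esum_(y in [set: U]) `|h x y|%:E < +oo)%E ->
  rsum [set: T] (fun x => rsum [set: U] (h x)) =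
  fine (\esum_(x in [set: T]) \esum_(y in [set: U]) (Num.max (h x y) 0)%:E)%E -
  fine (\esum_(x in [set: T]) \esum_(y in [set: U]) (Num.max (- h x y) 0)%:E)%E.
Proof.
pose pos x y := Num.max (h x y) 0; pose neg x y := Num.max (- h x y) 0 => sh.
(* Applied below to the positive and to the negative part of [h]. *)
have key (p : T -> U -> R) : (forall x y, 0 <= p x y) -> (forall x y, p x y <= `|h x y|) ->
    [/\ forall x, summable [set: U] (EFin \o p x),
        summable [set: T] (EFin \o (fun x => fine (\esum_(y in [set: U]) (p x y)%:E)%E))
      & fine (\esum_(x in [set: T]) \esum_(y in [set: U]) (p x y)%:E)%E =
        fine (\esum_(x in [set: T]) (fine (\esum_(y in [set: U]) (p x y)%:E))%:E)%E].
  move=> p0 ph.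
  have sp x : summable [set: U] (EFin \o p x).
    apply/(summable_ge0 _ (p0 x)).
    apply: (@le_lt_trans _ _ (\esum_(y in [set: U]) `|h x y|%:E)%E).
      by apply: le_esum => y _; rewrite lee_fin.
    apply: le_lt_trans sh.
    apply: (@esum_ge_term _ (fun x => \esum_(y in [set: U]) `|h x y|%:E)%E) => z.
    by apply: esum_ge0 => y _; rewrite lee_fin.
  have E : (\esum_(x in [set: T]) (fine (\esum_(y in [set: U]) (p x y)%:E))%:E =
      \esum_(x in [set: T]) \esum_(y in [set: U]) (p x y)%:E)%E.
    by apply: eq_esum => x _; rewrite (esum_fineK (p0 x) (sp x)).
  split=> //; last by rewrite E.
  apply/summable_ge0; first by move=> x; rewrite fine_ge0// esum_ge0// => y _; rewrite lee_fin.
  rewrite E; apply: le_lt_trans sh.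
  by apply: le_esum => x _; apply: le_esum => y _; rewrite lee_fin.
have pp x y : 0 <= pos x y by rewrite le_max lexx orbT.
have nn x y : 0 <= neg x y by rewrite le_max lexx orbT.
have [] := key _ pp; first by move=> x y; rewrite ge_max ler_norm normr_ge0.
move=> sp sp' ->.
have [] := key _ nn; first by move=> x y; rewrite ge_max -normrN ler_norm normr_ge0.
move=> sn sn' ->.
have f0 (p : T -> U -> R) : (forall x y, 0 <= p x y) ->
    forall x, 0 <= fine (\esum_(y in [set: U]) (p x y)%:E)%E.
  by move=> p0 x; rewrite fine_ge0// esum_ge0// => y _; rewrite lee_fin.
rewrite -(rsumB (f0 _ pp) (f0 _ nn) sp' sn').
congr rsum; apply/funext => x /=; rewrite -(rsumB (pp x) (nn x) (sp x) (sn x)).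
congr rsum; apply/funext => y /=.
by rewrite /pos /neg; case: (leP (h x y) 0); case: (leP (- h x y) 0) => ? ?; lra.
Qed.

End double_sums.

Section fubini.
Variables (R : realType) (T U : choiceType).

Lemma rsum_exchange (h : T -> U -> R) :
  (\esum_(x in [set: T]) \esum_(y in [set: U]) `|h x y|%:E < +oo)%E ->
  rsum [set: T] (fun x => rsum [set: U] (h x)) =
  rsum [set: U] (fun y => rsum [set: T] (h ^~ y)).
Proof.
move=> sh; rewrite rsum_rsum// [RHS]rsum_rsum; last first.
  by rewrite esum_exchange// => x y; rewrite lee_fin.
by congr (fine _ - fine _); apply: esum_exchange => x y; rewrite lee_fin le_max lexx orbT.
Qed.

Lemma csum_exchange (h : T -> U -> R[i]) :
  (\esum_(x in [set: T]) \esum_(y in [set: U]) (cnorm (h x y))%:E < +oo)%E ->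
  csum [set: T] (fun x => csum [set: U] (h x)) =
  csum [set: U] (fun y => csum [set: T] (h ^~ y)).
Proof.
move=> sh; rewrite /csum.
by congr (_ +i* _); apply: rsum_exchange; apply: le_lt_trans sh;
  apply: le_esum => x _; apply: le_esum => y _; rewrite lee_fin; case: (reim_le (h x y)).
Qed.

End fubini.

(** * Complex sums: conjugation, supports, real families *)

Section csum_more.
Variables (R : realType) (T : choiceType).
Implicit Types (f : T -> R[i]) (a : T).

Lemma csumJ f : csummable [set: T] f ->
  csum [set: T] (fun x => (f x)^*%C) = (csum [set: T] f)^*%C.
Proof.
move=> sf; rewrite /csum /=; congr (_ +i* _).
  by congr rsum; apply/funext => x /=; case: (f x).
rewrite -rsumN; last exact: csummable_im.
by congr rsum; apply/funext => x /=; case: (f x).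
Qed.

Lemma csumZr c f : csummable [set: T] f ->
  csum [set: T] (fun x => f x * c) = csum [set: T] f * c.
Proof.
by move=> sf; rewrite mulrC -csumZ//; congr csum; apply/funext => x; rewrite mulrC.
Qed.

Lemma esum_support (u : T -> \bar R) a : (forall x, 0 <= u x)%E ->
  (forall x, x != a -> u x = 0%E) -> (\esum_(x in [set: T]) u x = u a)%E.
Proof.
move=> u0 ua; rewrite -(esum_set1 (u0 a)) [RHS]esum_mkcond; apply: eq_esum => x _.
have [->|xa] := eqVneq x a; first by rewrite mem_set.
by rewrite memNset ?ua//= => /eqP; rewrite (negbTE xa).
Qed.

Lemma rsum_support (u : T -> R) a :
  (forall x, x != a -> u x = 0) -> rsum [set: T] u = u a.
Proof.
move=> ua; rewrite /rsum !(@esum_support _ a)//.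
- rewrite funeposE funenegE /= -!EFin_max /=.
  by case: (leP (u a) 0) => ?; case: (leP (- u a) 0) => ?; lra.
- by move=> x /ua /= xa; rewrite funenegE /= xa oppr0 -EFin_max maxxx.
- by move=> x /ua /= xa; rewrite funeposE /= xa maxxx.
Qed.

Lemma csum_support f a : (forall x, x != a -> f x = 0) -> csum [set: T] f = f a.
Proof.
move=> fa; rewrite /csum !(@rsum_support _ a) /=; first by case: (f a).
- by move=> x /fa ->.
- by move=> x /fa ->.
Qed.

(** Extension by zero turns a sum over a fibre into a sum over the whole type, to which
    [csum_exchange] applies. *)
Lemma csum_setE (P : pred T) f :
  csum [set x | P x] f = csum [set: T] (fun x => if P x then f x else 0).
Proof.
have E (u : T -> R) : rsum [set x | P x] u = rsum [set: T] (fun x => if P x then u x else 0).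
  rewrite /rsum; congr (fine _ - fine _); rewrite esum_mkcond; apply: eq_esum => x _.
  - rewrite mem_setE unfold_in !funeposE /=; case: (P x) => //=; by rewrite -EFin_max maxxx.
  - rewrite mem_setE unfold_in !funenegE /=; case: (P x) => //=; by rewrite -EFin_max oppr0 maxxx.
by rewrite /csum !E; congr (_ +i* _); congr rsum; apply/funext => x /=; case: ifP.
Qed.

(** The factor 2 comes from bounding real and imaginary parts separately. Extended-real values allow
    a further summation with no finiteness proof. *)
Lemma cnorm_csum_esum f : csummable [set: T] f ->
  ((cnorm (csum [set: T] f))%:E <= 2%:E * \esum_(x in [set: T]) (cnorm (f x))%:E)%E.
Proof.
move=> sf; rewrite -(esum_fineK _ sf) => [|x]; last exact: cnorm_ge0.
by rewrite -EFinM lee_fin cnorm_csum.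
Qed.

Lemma csummableE f :
  csummable [set: T] f <-> (\esum_(x in [set: T]) (cnorm (f x))%:E < +oo)%E.
Proof. by apply: summable_ge0 => x; exact: cnorm_ge0. Qed.

Lemma Lp2_mul f g : Lp 2 f -> Lp 2 g -> csummable [set: T] (fun x => f x * g x).
Proof.
move=> /Lp2E sf /Lp2E sg; apply: summable_le (summableRD sf sg) => x _ /=.
rewrite !ger0_norm ?addr_ge0 ?sqr_ge0 ?cnorm_ge0// ComplexField.Normc.normcM.
have := sqr_ge0 (cnorm (f x) - cnorm (g x)); rewrite sqrrB.
have := mulr_ge0 (cnorm_ge0 (f x)) (cnorm_ge0 (g x)); lra.
Qed.

Lemma cnormJ (z : R[i]) : cnorm z^*%C = cnorm z.
Proof. by case: z => a b /=; rewrite sqrrN. Qed.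

Lemma Lp2J f : Lp 2 f -> Lp 2 (fun x => (f x)^*%C).
Proof. by rewrite /Lp; under [X in _ -> (X < _)%E]eq_esum do rewrite cnormJ. Qed.

Lemma cnorm_real (x : R) : 0 <= x -> cnorm x%:C = x.
Proof. by move=> x0 /=; rewrite expr0n/= addr0 sqrtr_sqr ger0_norm. Qed.

Lemma csum_realE (p : T -> R) : (forall x, 0 <= p x) -> summable [set: T] (EFin \o p) ->
  csum [set: T] (fun x => (p x)%:C) = (fine (\esum_(x in [set: T]) (p x)%:E)%E)%:C.
Proof.
move=> p0 sp; rewrite /csum -(rsum_ge0 p0 sp) /real_complex_def; congr (_ +i* _).
(* [rsum_support] needs a point to show that the imaginary part sums to 0, so the empty index type
   is treated apart. *)
have [x0|noT] := pselect (exists x : T, True).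
  by case: x0 => x0 _; rewrite (@rsum_support _ x0).
rewrite /rsum !esum1 ?subrr//= => x _; first by case: noT; exists x.
by case: noT; exists x.
Qed.

End csum_more.

(** * The l1-norm and the inclusion of l1 in l2 *)

Section l1norm.
Variables (R : realType) (T : choiceType).

Definition l1norm (w : T -> R[i]) : \bar R := (\esum_(x in [set: T]) (cnorm (w x))%:E)%E.

Lemma l1norm_ge0 w : (0 <= l1norm w)%E.
Proof. by apply: esum_ge0 => x _; rewrite lee_fin cnorm_ge0. Qed.

Lemma Lp1_l1norm w : Lp 1 w <-> (l1norm w < +oo)%E.
Proof. by rewrite /Lp /l1norm; under [X in (X < _)%E <-> _]eq_esum do rewrite expr1. Qed.

Lemma cnorm_le_l1norm w x : ((cnorm (w x))%:E <= l1norm w)%E.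
Proof. by apply: (@esum_ge_term _ _ (fun x => (cnorm (w x))%:E)) => y;
  rewrite lee_fin cnorm_ge0. Qed.

Lemma Lp1_bounded w : Lp 1 w -> exists2 B : R, 0 <= B & (l1norm w <= B%:E)%E.
Proof.
move=> /Lp1_l1norm sw; exists (fine (l1norm w)); first exact/fine_ge0/l1norm_ge0.
by rewrite fineK// ge0_fin_numE// l1norm_ge0.
Qed.

(** The values of an l1 function are bounded by its norm, so its squared moduli are at most [B]
    times its moduli. *)
Lemma Lp1_Lp2 (w : T -> R[i]) : Lp 1 w -> Lp 2 w.
Proof.
move=> sw; have [B B0 wB] := Lp1_bounded sw; apply/Lp2E.
have := summableRZ B ((Lp1E w).1 sw); apply: summable_le => x _ /=.
have w0 := cnorm_ge0 (w x); rewrite !ger0_norm ?sqr_ge0 ?mulr_ge0//.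
by rewrite ler_wpM2r// -lee_fin (le_trans (cnorm_le_l1norm _ _) wB).
Qed.

End l1norm.

(** * Convolution and passage to quotients *)

Section convolution_more.
Variables (R : realType) (G : groupType).
Implicit Types (u v w : G -> R[i]).

(** Convolving the moduli sums the moduli of the terms of [convol], which supplies the absolute
    summability that [csum_exchange] demands. *)
Let cabs (v : G -> R[i]) : G -> R[i] := fun x => (cnorm (v x))%:C.

Let cnorm_cabs v x : cnorm (cabs v x) = cnorm (v x).
Proof. by rewrite cnorm_real// cnorm_ge0. Qed.

Let Lp_cabs p v : Lp p v -> Lp p (cabs v).
Proof. by rewrite /Lp; under [X in _ -> (X < _)%E]eq_esum do rewrite cnorm_cabs. Qed.

Let cnorm_convol_cabs v w g : Lp 2 v -> Lp 1 w ->
  ((cnorm (convol (cabs v) (cabs w) g))%:E =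
   \esum_(x in [set: G]) (cnorm (v x * w (x^-1 * g)%g))%:E)%E.
Proof.
move=> sv sw; have s := convol_summable g sv sw.
have c0 x : 0 <= cnorm (v x * w (x^-1 * g)%g) by exact: cnorm_ge0.
rewrite /convol (_ : (fun _ => _) = fun x => (cnorm (v x * w (x^-1 * g)%g))%:C); last first.
  by apply/funext => x; rewrite ComplexField.Normc.normcM rmorphM.
rewrite (csum_realE c0 s) cnorm_real ?esum_fineK//.
by apply/fine_ge0/esum_ge0 => x _; rewrite lee_fin.
Qed.

(** After the exchange, the sum over [g] is invariant under [g |-> x^-1 g] and the product splits.
    As the moduli stay inside the double sum, the identity also yields the summability used in
    [push_convol]. *)
Lemma l1norm_convol u w : Lp 1 u -> Lp 1 w ->
  (\esum_(g in [set: G]) \esum_(x in [set: G]) (cnorm (u x * w (x^-1 * g)%g))%:E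
   = l1norm u * l1norm w)%E.
Proof.
move=> su sw; rewrite esum_exchange => [|x g]; last by rewrite lee_fin cnorm_ge0.
have [B B0 wB] := Lp1_bounded sw.
have wE : l1norm w = (fine (l1norm w))%:E.
  by rewrite fineK// ge0_fin_numE ?l1norm_ge0//; exact/Lp1_l1norm.
rewrite [in RHS]wE muleC -esumZl ?fine_ge0 ?l1norm_ge0// => [|x]; last by rewrite lee_fin cnorm_ge0.
apply: eq_esum => x _; rewrite -wE muleC.
under eq_esum do rewrite ComplexField.Normc.normcM EFinM.
rewrite esumZl ?cnorm_ge0// => [|g]; last by rewrite lee_fin cnorm_ge0.
by rewrite -(esum_bij (fun g => (cnorm (w g))%:E) (bij_mull x^-1)%g).
Qed.

Lemma convol_Lp1 u w : Lp 1 u -> Lp 1 w -> Lp 1 (convol u w).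
Proof.
move=> su sw; apply/Lp1_l1norm.
apply: (@le_lt_trans _ _ (2%:E * (l1norm u * l1norm w))%E); last first.
  have [A A0 uA] := Lp1_bounded su; have [B B0 wB] := Lp1_bounded sw.
  apply: lte_mul_pinfty => //; apply: (@le_lt_trans _ _ (A * B)%:E); last exact: ltry.
  by rewrite EFinM lee_pmul// l1norm_ge0.
rewrite -l1norm_convol// -esumZl// => [|g]; last by apply: esum_ge0 => x _;
  rewrite lee_fin cnorm_ge0.
by apply: le_esum => g _; apply: cnorm_csum_esum; exact: convol_summable (Lp1_Lp2 su) sw.
Qed.

Lemma convolA v u w : Lp 2 v -> Lp 1 u -> Lp 1 w ->
  convol (convol v u) w = convol v (convol u w).
Proof.
move=> sv su sw; apply/funext => g.
have suw := convol_Lp1 su sw.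
rewrite /convol.
transitivity (csum [set: G] (fun y => csum [set: G]
    (fun x => v x * u (x^-1 * y)%g * w (y^-1 * g)%g))).
  by congr csum; apply/funext => y; rewrite csumZr//; exact: convol_summable.
rewrite csum_exchange; last first.
  (* [v] is only in l2. The convolution of the moduli of [v] and [u] is again in l2, and its
     convolution with [w] in l1 converges absolutely at [g]. *)
  rewrite (eq_esum (b := fun y => (cnorm (convol (cabs v) (cabs u) y * w (y^-1 * g)%g))%:E)).
    exact: (csummableE _).1 (convol_summable g (convol_Lp2 (Lp_cabs sv) (Lp_cabs su)) sw).
  move=> y _; rewrite ComplexField.Normc.normcM EFinM cnorm_convol_cabs// muleC.
  rewrite -esumZl ?cnorm_ge0// => [|x]; last by rewrite lee_fin cnorm_ge0.
  by apply: eq_esum => x _; rewrite ComplexField.Normc.normcM EFinM muleC.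
congr csum; apply/funext => x; rewrite -csumZ; last exact: convol_summable (Lp1_Lp2 su) sw.
rewrite (csum_reindex _ (bij_mull x)); congr csum; apply/funext => z /=.
by rewrite mulKg invgM !mulgA mulrA.
Qed.

Lemma convol1 v : convol v (@dirac1 R G) = v.
Proof.
apply/funext => g; rewrite /convol (@csum_support _ _ _ g) /dirac1 ?mulVg ?eqxx ?mulr1//.
move=> x xg; rewrite (_ : _ == _ = false) ?mulr0//; apply/negbTE; apply: contra_neq xg => h.
by rewrite -[LHS]mulg1 -h mulVKg.
Qed.

(** An exchange of sums, showing that right convolutions by [u] and [l1_star u] are adjoint. The
    vectors [v'] and [w'] are tied to convolutions by equations, so that no membership proof occurs
    in the statement. *)
Lemma inner_convol (v w v' w' : L2 R G) u : Lp 1 u -> v' = convol v u :> (G -> R[i]) ->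
  w' = convol w (l1_star u) :> (G -> R[i]) -> inner v' w = inner v w'.
Proof.
move=> su Ev Ew; have sus := l1_star_Lp1 su.
have sv := L2P v; have sw := L2P w; rewrite /inner Ev Ew.
transitivity (csum [set: G] (fun g => csum [set: G]
    (fun x => v x * u (x^-1 * g)%g * (w g)^*%C))).
  by congr csum; apply/funext => y; rewrite csumZr//; exact: convol_summable.
rewrite csum_exchange; last first.
  rewrite (eq_esum (b := fun y => (cnorm (convol (cabs v) (cabs u) y * (w y)^*%C))%:E)).
    exact: (csummableE _).1 (Lp2_mul (convol_Lp2 (Lp_cabs sv) (Lp_cabs su)) (Lp2J sw)).
  move=> y _; rewrite ComplexField.Normc.normcM EFinM cnorm_convol_cabs// muleC.
  rewrite -esumZl ?cnorm_ge0// => [|x]; last by rewrite lee_fin cnorm_ge0.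
  by apply: eq_esum => x _; rewrite ComplexField.Normc.normcM EFinM muleC.
congr csum; apply/funext => x; rewrite -csumJ; last exact: convol_summable.
rewrite -csumZ.
  congr csum; apply/funext => g; rewrite /l1_star invgM invgK rmorphM /= conjcK.
  by rewrite [in RHS]mulrA mulrAC.
apply: csummable_le (convol_summable x sw sus) => g.
by rewrite cnormJ.
Qed.

(** The argument of [convol_Lp2_bound] with its constant made explicit: it depends only on a bound
    for the l1-norm, so it can be shared by all the quotients. *)
Lemma young v w (B : R) : Lp 2 v -> Lp 1 w -> 0 < B -> (l1norm w <= B%:E)%E ->
  (\esum_(g in [set: G]) (cnorm (convol v w g) ^+ 2)%:E <=
   ((2 * B) ^+ 2)%:E * \esum_(g in [set: G]) (cnorm (v g) ^+ 2)%:E)%E.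
Proof.
move=> sv sw B0 Bge; have sv2 := (Lp2E v).1 sv; have sw1 := (Lp1E w).1 sw.
have v0 x : 0 <= cnorm (v x) by exact: cnorm_ge0.
have w0 x : 0 <= cnorm (w x) by exact: cnorm_ge0.
have u0 g x : (0 <= (cnorm (v x) ^+ 2 * cnorm (w (x^-1 * g)%g))%:E)%E.
  by rewrite lee_fin mulr_ge0 ?sqr_ge0.
have B4 : 0 <= 4 * B by rewrite mulr_ge0// ltW.
apply: (@le_trans _ _ (\esum_(g in [set: G]) ((4 * B)%:E *
    \esum_(x in [set: G]) (cnorm (v x) ^+ 2 * cnorm (w (x^-1 * g)%g))%:E))%E).
  apply: le_esum => g _.
  have := young_pointwise g v0 w0 Bge B0 sv2 sw1; set S := fine _ => SQ.
  have S0 : 0 <= S by rewrite fine_ge0// esum_ge0// => x _; rewrite lee_fin mulr_ge0.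
  rewrite (EFinM 4 B) -muleA; apply: (@le_trans _ _ (4%:E * (S ^+ 2)%:E)%E); last first.
    by rewrite lee_wpmul2l// lee_fin.
  rewrite -EFinM lee_fin (_ : 4 * S ^+ 2 = (2 * S) ^+ 2); last by ring.
  rewrite ler_pXn2r// ?nnegrE ?cnorm_ge0// ?mulr_ge0//.
  apply: le_trans (cnorm_csum (convol_summable g sv sw)) _; rewrite ler_wpM2l//.
  rewrite (_ : S = fine (\esum_(x in [set: G]) (cnorm (v x * w (x^-1 * g)%g))%:E)%E)//.
  by congr fine; apply: eq_esum => x _; rewrite ComplexField.Normc.normcM.
rewrite (esumZl _ B4) => [|g]; last exact: esum_ge0.
have -> : ((2 * B) ^+ 2)%:E = ((4 * B)%:E * B%:E)%E by rewrite -EFinM; congr EFin; ring.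
rewrite -muleA lee_wpmul2l ?lee_fin// (esum_exchange u0).
rewrite -(esumZl _ (ltW B0)) => [|x]; last by rewrite lee_fin sqr_ge0.
apply: le_esum => x _; under eq_esum do rewrite EFinM.
rewrite (esumZl _ (sqr_ge0 _)) => [|g]; last by rewrite lee_fin.
rewrite muleC lee_wpmul2r ?lee_fin ?sqr_ge0//.
by rewrite -(esum_bij (fun g => (cnorm (w g))%:E) (bij_mull x^-1)%g).
Qed.

Lemma l1norm_star w : l1norm (l1_star w) = l1norm w.
Proof.
rewrite /l1norm (esum_bij (fun g => (cnorm (w g))%:E) (bij_invMr 1%g)).
by apply: eq_esum => g _; rewrite /l1_star cnormJ mulg1.
Qed.

End convolution_more.

(** * Pushforward of functions to a quotient group *)

Section push.
Variables (R : realType) (G : groupType) (N : normalSubgroup G).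
Implicit Types (f h w : G -> R[i]) (d : quot N).

(** The function underlying [pushL1], without its summability proof. *)
Definition push f d : R[i] := csum [set g | quot_pi N g = d] f.

Lemma pushE f d : push f d = csum [set: G] (fun g => if quot_pi N g == d then f g else 0).
Proof.
by rewrite -csum_setE /push; congr csum; apply/seteqP; split => g /eqP.
Qed.

Let csummable_if f (P : pred G) : Lp 1 f -> csummable [set: G] (fun g => if P g then f g else 0).
Proof.
move=> /Lp1E; apply: csummable_le => g; case: ifP => // _.
by rewrite ComplexField.Normc.normc0 cnorm_ge0.
Qed.

(** After the exchange, each [g] contributes only through its own class. *)
Let esum_fiber f : (\esum_(d in [set: quot N]) \esum_(g in [set: G])
    (cnorm (if quot_pi N g == d then f g else 0))%:E)%E = l1norm f.
Proof.
rewrite esum_exchange => [|d g]; last by rewrite lee_fin cnorm_ge0.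
apply: eq_esum => g _; rewrite (@esum_support _ _ _ (quot_pi N g)) ?eqxx//.
  by move=> d; rewrite lee_fin cnorm_ge0.
by move=> d; rewrite eq_sym => /negbTE ->; rewrite ComplexField.Normc.normc0.
Qed.

(** The factor 2 is that of [cnorm_csum]; what matters is that it does not depend on [N]. *)
Lemma l1norm_push f : Lp 1 f -> (l1norm (push f) <= 2%:E * l1norm f)%E.
Proof.
move=> sf; rewrite -esum_fiber -esumZl// => [|d]; last first.
  by apply: esum_ge0 => g _; rewrite lee_fin cnorm_ge0.
apply: le_esum => d _; rewrite pushE; apply: cnorm_csum_esum.
exact: csummable_if.
Qed.

Lemma push_dirac1 : push (@dirac1 R G) = @dirac1 R (quot N).
Proof.
apply/funext => d; rewrite pushE (@csum_support _ _ _ 1%g) /dirac1 ?eqxx.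
  by rewrite eq_sym; case: eqP.
by move=> x /negbTE ->; rewrite if_same.
Qed.

Lemma push_star f : Lp 1 f -> push (l1_star f) = l1_star (push f).
Proof.
move=> sf; apply/funext => d; rewrite /l1_star !pushE -csumJ; last exact: csummable_if.
rewrite (csum_reindex _ (bij_invMr 1%g)); congr csum; apply/funext => g /=.
rewrite mulg1 invgK quot_piV -[quot_inv _]/((quot_pi N g)^-1)%g.
rewrite (can2_eq (@invgK _) (@invgK _)).
by case: ifP => // _; rewrite rmorph0.
Qed.

Lemma push_convol f h : Lp 1 f -> Lp 1 h ->
  push (convol f h) = convol (push f) (push h).
Proof.
move=> sf sh; apply/funext => d; rewrite pushE.
have pf := push_Lp1 N sf; have ph := push_Lp1 N sh.
(* Both sides reduce to this sum: the left one by the substitution [g = x z], the right one because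
   [x] contributes only for its own class [c]. *)
transitivity (csum [set: G] (fun x => f x * push h ((quot_pi N x)^-1 * d)%g)).
  transitivity (csum [set: G] (fun g => csum [set: G]
      (fun x => (if quot_pi N g == d then f x * h (x^-1 * g)%g else 0)))).
    congr csum; apply/funext => g; case: ifP => // _.
    by rewrite (@csum_support _ _ _ 1%g).
  rewrite csum_exchange; last first.
    apply: (@le_lt_trans _ _ (l1norm f * l1norm h)%E); last first.
      have [A A0 uA] := Lp1_bounded sf; have [B B0 wB] := Lp1_bounded sh.
      apply: (@le_lt_trans _ _ (A * B)%:E); last exact: ltry.
      by rewrite EFinM lee_pmul// l1norm_ge0.
    rewrite -l1norm_convol//; apply: le_esum => g _; apply: le_esum => x _.
    by case: ifP => _; rewrite lee_fin// ComplexField.Normc.normc0 cnorm_ge0.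
  congr csum; apply/funext => x; rewrite pushE -csumZ; last exact: csummable_if.
  rewrite (csum_reindex _ (bij_mull x)); congr csum; apply/funext => z /=.
  rewrite mulKg quot_piM -[quot_mul _ _]/(quot_pi N x * quot_pi N z)%g.
  rewrite (can2_eq (mulKg _) (mulVKg _)).
  by case: ifP => // _; rewrite mulr0.
symmetry.
transitivity (csum [set: quot N] (fun c => csum [set: G]
    (fun x => (if quot_pi N x == c then f x else 0) * push h (c^-1 * d)%g))).
  by congr csum; apply/funext => c; rewrite [push f _]pushE csumZr//; exact: csummable_if.
rewrite csum_exchange; last first.
  have [B B0 hB] := Lp1_bounded ph.
  apply: (@le_lt_trans _ _ (B%:E * l1norm f)%E); last first.
    by apply: lte_mul_pinfty => //; exact/Lp1_l1norm.
  rewrite -esum_fiber -esumZl// => [|c]; last first.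
    by apply: esum_ge0 => g _; rewrite lee_fin cnorm_ge0.
  apply: le_esum => c _; rewrite -esumZl// => [|x]; last by rewrite lee_fin cnorm_ge0.
  apply: le_esum => x _; rewrite ComplexField.Normc.normcM EFinM muleC.
  apply: lee_wpmul2r; first by rewrite lee_fin cnorm_ge0.
  exact: le_trans (cnorm_le_l1norm _ _) hB.
congr csum; apply/funext => x; rewrite (@csum_support _ _ _ (quot_pi N x)) ?eqxx//.
by move=> c; rewrite eq_sym => /negbTE ->; rewrite mul0r.
Qed.

End push.

(** The pushforward takes at 1 the sum of [w] over [Gn n]. A finite set [K] carries the absolute sum
    of the real parts up to [e], and for large [n] it meets [Gn n] at most in 1, so the terms other
    than the one at 1 contribute at most [e]. *)
Lemma push1_cvg (R : realType) (G : groupType) (Gn : nat -> normalSubgroup G)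
    (w : G -> R[i]) : tends_to_trivial Gn -> Lp 1 w ->
  complex.Re (push (N := Gn n) w 1%g) @[n --> \oo] --> complex.Re (w 1%g).
Proof.
move=> Gn1 sw; apply/cvgrPdist_le => /= e e0.
have sr : summable [set: G] (EFin \o (@complex.Re R \o w)).
  exact: csummable_re ((Lp1E w).1 sw).
set r := @complex.Re R \o w in sr.
have a0 x : 0 <= `|r x| by [].
have sa : summable [set: G] (EFin \o (fun x => `|r x|)).
  by apply: summable_le sr => x _ /=; rewrite normr_id.
have [K [Kfin _] KE] : exists2 K : set G, finite_set K /\ K `<=` [set: G] &
    (\esum_(x in [set: G]) `|r x|%:E - e%:E < \sum_(x \in K) `|r x|%:E)%E.
  have sfin : (\esum_(x in [set: G]) `|r x|%:E)%E \is a fin_num.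
    by rewrite -(esum_fineK a0 sa).
  have [_ [K [Kf KG] <-] h] := ub_ereal_sup_adherent e0 sfin.
  by exists K.
have [n0 n01 hn] : exists2 n0, (1 <= n0)%N & forall n, (n0 <= n)%N ->
    forall g, g \in Gn n -> K g -> g = 1%g.
  (* Adding 1 to [K] makes the set nonempty and puts [K] among the elements [x^-1 y]. *)
  have [] := Gn1 (1%g |` K); first by rewrite finite_setU.
    by exists 1%g; left.
  move=> n0 n01 h; exists n0 => // n /h E g gN Kg.
  have : [set 1%g] g; last by [].
  rewrite -E; split=> //; exists 1%g; first by left.
  by exists g; [right|rewrite invg1 mul1g].
near=> n.
have nn0 : (n0 <= n)%N by near: n; exists n0.
rewrite -[rsum _ _]/(complex.Re (push (N := Gn n) w 1%g)) pushE.
(* The sum splits into the term at 1, [i1], and the error [q], which vanishes on [K]. *)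
pose q x := if x == 1%g then 0 else if x \in Gn n then r x else 0.
pose i1 x := if x == 1%g then r x else 0.
have sq : summable [set: G] (EFin \o q).
  apply: summable_le sr => x _; rewrite /q; case: ifP => _; first by rewrite normr0.
  by case: ifP => _; rewrite ?normr0.
have s1 : summable [set: G] (EFin \o i1).
  by apply: summable_le sr => x _; rewrite /i1; case: ifP => _; rewrite ?normr0.
have piN x : (quot_pi (Gn n) x == 1%g) = (x \in Gn n).
  apply/eqP/idP => [/esym/quot_piP|xN]; first by rewrite invg1 mul1g.
  by apply/esym/quot_piP; rewrite invg1 mul1g.
have -> : complex.Re (csum [set: G] (fun g => if quot_pi (Gn n) g == 1%g then w g else 0)) =
    rsum [set: G] (i1 \+ q).
  rewrite /=; congr rsum; apply/funext => x /=; rewrite piN /i1 /q.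
  have [->|x1] := eqVneq x 1%g; first by rewrite gpred1 addr0.
  by rewrite add0r; case: ifP.
rewrite (rsumD s1 sq) (@rsum_support _ _ i1 1%g); last by move=> x /negbTE h; rewrite /i1 h.
rewrite /i1 eqxx opprD addrA subrr add0r normrN.
apply: le_trans (rsum_le sq) _.
have sq' : summable [set: G] (EFin \o (fun x => `|q x|)).
  by apply: summable_le sq => x _ /=; rewrite normr_id.
have q0 x : 0 <= `|q x| by [].
rewrite -lee_fin (esum_fineK q0 sq').
have -> : (\esum_(x in [set: G]) `|q x|%:E = \esum_(x in ~` K) `|q x|%:E)%E.
  rewrite [RHS]esum_mkcond; apply: eq_esum => x _; case: ifPn => //.
  rewrite notin_setE /= => /contrapT Kx; rewrite /q; case: eqP => [|x1]; first by rewrite normr0.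
  by case: ifP => [xN|]; [have := hn _ nn0 x xN Kx|rewrite normr0].
apply: (@le_trans _ _ (\esum_(x in ~` K) `|r x|%:E)%E).
  apply: le_esum => x _; rewrite lee_fin /q; case: ifP => _; first by rewrite normr0.
  by case: ifP => _; rewrite ?normr0.
have r0 x : (0 <= `|r x|%:E)%E by rewrite lee_fin.
move: KE; rewrite (@esumID _ _ K [set: G] _ (fun x _ => r0 x)) !setTI -(esum_fset Kfin (fun x _
  => r0 x)).
have KT : (\esum_(x in K) `|r x|%:E)%E \is a fin_num.
  rewrite ge0_fin_numE ?esum_ge0//; apply: le_lt_trans sr; rewrite [leLHS]esum_mkcond.
  by apply: le_esum => x _; case: ifP.
by rewrite lteBlDr// lteD2lE// => /ltW.
Unshelve. all: by end_near.
Qed.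

(** * The Hilbert space L2 *)

Lemma geometric_small (R : realType) (K t : R) : 0 <= t < 1 ->
  forall e, 0 < e -> exists N, forall n, (N <= n)%N -> K * t ^+ n < e.
Proof.
move=> /andP[t0 t1] e e0; have t1' : `|t| < 1 by rewrite ger0_norm.
have /cvgrPdist_lt /(_ e e0) [N _ hN] := @cvg_geometric R K t t1'.
exists N => n /hN /=; rewrite sub0r normrN; exact/le_lt_trans/ler_norm.
Qed.

Lemma geometric_cauchy_cvg (R : realType) (a : nat -> R) (K t : R) : 0 <= t < 1 ->
  (forall n k, `|a (n + k)%N - a n| <= K * t ^+ n) -> cvg (a @ \oo).
Proof.
move=> t01 ha; apply/cauchy_cvgP/cauchy_exP => e e0.
have [N hN] := geometric_small K t01 e0.
exists (a N); exists N => // n /= Nn; rewrite /ball /= distrC -(subnKC Nn).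
exact: le_lt_trans (ha _ _) (hN _ (leqnn N)).
Qed.

Section L2_hilbert.
Variables (R : realType) (T : choiceType).
Local Notation H := (L2 R T).
Implicit Types (u v w : H) (c : R) (z : R[i]).

(** The underlying real inner product suffices for norms, Cauchy-Schwarz and symmetry of operators;
    multiplication by ['i] is skew for it ([rinner_i]). *)
Definition rinner v w : R := complex.Re (inner v w).

Let inner_summable v w : csummable [set: T] (fun x => v x * (w x)^*%C).
Proof. exact: Lp2_mul (L2P v) (Lp2J (L2P w)). Qed.

Lemma innerJ v w : inner w v = (inner v w)^*%C.
Proof.
rewrite /inner -csumJ//; congr csum; apply/funext => x.
by rewrite rmorphM /= conjcK mulrC.
Qed.

Lemma innerP z u v w : inner (z *: u + v) w = z * inner u w + inner v w.
Proof.
rewrite /inner -csumZ// -csumD//; last exact: csummableZ.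
by congr csum; apply/funext => x /=; rewrite mulrA -mulrDl.
Qed.

Let inner0 w : inner 0 w = 0.
Proof.
have := innerP 1 0 0 w; rewrite scale1r addr0 mul1r -[LHS]addr0 => /addrI.
by move=> <-.
Qed.

Let innerZ z v w : inner (z *: v) w = z * inner v w.
Proof. by rewrite -[z *: v]addr0 innerP inner0 addr0. Qed.

Lemma rinnerC v w : rinner v w = rinner w v.
Proof. by rewrite /rinner innerJ; case: (inner w v). Qed.

Lemma rinnerDl u v w : rinner (u + v) w = rinner u w + rinner v w.
Proof.
by rewrite /rinner -[u in LHS]scale1r innerP mul1r; case: (inner u w) (inner v w) => ? ? [].
Qed.

Lemma rinnerZl c v w : rinner (c%:C *: v) w = c * rinner v w.
Proof.
rewrite /rinner innerZ; case: (inner v w) => x y /=.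
by rewrite mul0r subr0.
Qed.

Lemma rinnerNl v w : rinner (- v) w = - rinner v w.
Proof. by rewrite -scaleN1r -(rmorph1 (real_complex R)) -rmorphN rinnerZl mulN1r. Qed.

Lemma rinnerDr u v w : rinner w (u + v) = rinner w u + rinner w v.
Proof. by rewrite rinnerC rinnerDl !(rinnerC w). Qed.

Lemma rinnerZr c v w : rinner w (c%:C *: v) = c * rinner w v.
Proof. by rewrite rinnerC rinnerZl (rinnerC w). Qed.

Lemma rinnerNr v w : rinner w (- v) = - rinner w v.
Proof. by rewrite rinnerC rinnerNl (rinnerC w). Qed.

Lemma rinner_i v w : rinner ('i *: v) w = - rinner v ('i *: w).
Proof.
rewrite /rinner (innerJ ('i *: w)) !innerZ (innerJ w v); case: (inner v w) => x y /=.
by rewrite !mul0r !mul1r !sub0r; ring.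
Qed.

Lemma l2norm_ge0 v : 0 <= l2norm v.
Proof. exact: sqrtr_ge0. Qed.

Lemma l2norm_sqrE v : (l2norm v ^+ 2)%:E = (\esum_(x in [set: T]) (cnorm (v x) ^+ 2)%:E)%E.
Proof.
rewrite /l2norm sqr_sqrtr; last by apply/fine_ge0/esum_ge0 => x _; rewrite lee_fin sqr_ge0.
by rewrite (esum_fineK (fun x => sqr_ge0 (cnorm (v x))) ((Lp2E v).1 (L2P v))).
Qed.

Lemma l2norm_sqr v : l2norm v ^+ 2 = rinner v v.
Proof.
have p0 x : 0 <= cnorm (v x) ^+ 2 by exact: sqr_ge0.
have s := (Lp2E v).1 (L2P v).
rewrite /rinner /inner (_ : (fun x => v x * _) = fun x => (cnorm (v x) ^+ 2)%:C); last first.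
  apply/funext => x; case: (v x) => a b /=.
  by rewrite sqr_sqrtr ?addr_ge0 ?sqr_ge0//; apply/eqP; rewrite eq_complex /=; apply/andP;
    split; apply/eqP; ring.
by rewrite (csum_realE p0 s) /=; apply: EFin_inj; rewrite l2norm_sqrE esum_fineK.
Qed.

Lemma cnorm_le_l2norm v x : cnorm (v x) <= l2norm v.
Proof.
rewrite -(@ler_pXn2r _ 2)// ?nnegrE ?cnorm_ge0 ?l2norm_ge0// -lee_fin l2norm_sqrE.
by apply: (@esum_ge_term _ _ (fun x => (cnorm (v x) ^+ 2)%:E)) => y; rewrite lee_fin sqr_ge0.
Qed.

Lemma l2norm_eq0 v : l2norm v = 0 -> v = 0.
Proof.
move=> v0; apply/val_inj/funext => x /=; have := cnorm_le_l2norm v x.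
rewrite v0 => h; apply: ComplexField.Normc.eq0_normc.
by apply/eqP; rewrite eq_le h cnorm_ge0.
Qed.

(** Cauchy-Schwarz, from [0 <= |v - t w|^2] at the minimising [t]. *)
Lemma rinner_le v w : rinner v w <= l2norm v * l2norm w.
Proof.
have [w0|w0] := eqVneq (l2norm w) 0.
  by rewrite w0 mulr0 (l2norm_eq0 w0) -[0]/(0 : H) -(scale0r (0 : H)) -[0]/(0%:C) rinnerZr mul0r.
have wp : 0 < l2norm w by rewrite lt_def w0 l2norm_ge0.
have [|vw] := leP (rinner v w) 0; first by move/le_trans; apply; rewrite mulr_ge0 ?l2norm_ge0.
rewrite -(@ler_pXn2r _ 2)// ?nnegrE ?mulr_ge0 ?l2norm_ge0 ?(ltW vw)//.
pose t := rinner v w / l2norm w ^+ 2.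
have : 0 <= l2norm (v - t%:C *: w) ^+ 2 by exact: sqr_ge0.
rewrite l2norm_sqr !(rinnerDl, rinnerDr, rinnerNl, rinnerNr, rinnerZl, rinnerZr) (rinnerC w v)
  -!l2norm_sqr.
rewrite [X in 0 <= X -> _](_ : _ =
    ((l2norm v * l2norm w) ^+ 2 - rinner v w ^+ 2) / l2norm w ^+ 2); last by rewrite /t; field.
by rewrite pmulr_lge0 ?invr_gt0 ?exprn_gt0// subr_ge0.
Qed.

Lemma l2normZ z v : l2norm (z *: v) = cnorm z * l2norm v.
Proof.
apply: (@pexpIrn _ 2) => //; rewrite ?nnegrE ?mulr_ge0 ?cnorm_ge0 ?l2norm_ge0//.
apply: EFin_inj; rewrite exprMn (EFinM (_ ^+ 2) (_ ^+ 2)) !l2norm_sqrE -esumZl ?sqr_ge0// =>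
  [|x]; last first.
  by rewrite lee_fin sqr_ge0.
by apply: eq_esum => x _; rewrite -EFinM -exprMn -ComplexField.Normc.normcM.
Qed.

Lemma l2normZr c v : l2norm (c%:C *: v) = `|c| * l2norm v.
Proof. by rewrite l2normZ /= expr0n/= addr0 sqrtr_sqr. Qed.

Lemma l2normN v : l2norm (- v) = l2norm v.
Proof. by rewrite -scaleN1r -(rmorph1 (real_complex R)) -rmorphN l2normZr normrN1 mul1r. Qed.

Lemma l2norm0 : l2norm (0 : H) = 0.
Proof. by rewrite -(scale0r (0 : H)) -[0]/(0%:C) l2normZr normr0 mul0r. Qed.

Lemma l2norm_gt0 v : v != 0 -> 0 < l2norm v.
Proof. by rewrite lt_def l2norm_ge0 andbT; apply: contra_neq; exact: l2norm_eq0. Qed.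

Lemma l2normD u v : l2norm (u + v) <= l2norm u + l2norm v.
Proof.
rewrite -(@ler_pXn2r _ 2)// ?nnegrE ?addr_ge0 ?l2norm_ge0//.
rewrite l2norm_sqr !(rinnerDl, rinnerDr) (rinnerC v u) sqrrD !l2norm_sqr.
by have := rinner_le u v; lra.
Qed.

Lemma l2norm_sqrB u v :
  l2norm (u - v) ^+ 2 = l2norm u ^+ 2 - 2 * rinner u v + l2norm v ^+ 2.
Proof.
by rewrite !l2norm_sqr !(rinnerDl, rinnerDr, rinnerNl, rinnerNr) (rinnerC v u); ring.
Qed.

Lemma l2norm_distC u v : l2norm (u - v) = l2norm (v - u).
Proof. by rewrite -l2normN opprB. Qed.

Lemma l2normB u v w : l2norm (u - w) <= l2norm (u - v) + l2norm (v - w).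
Proof. by have := l2normD (u - v) (v - w); rewrite addrA subrK. Qed.

Let geometric_tail (u : nat -> H) (C t : R) : 0 <= C -> 0 <= t < 1 ->
  (forall n, l2norm (u n.+1 - u n) <= C * t ^+ n) ->
  forall n k, l2norm (u (n + k)%N - u n) <= C / (1 - t) * t ^+ n.
Proof.
move=> C0 /andP[t0 t1] hu n k; have t1' : 0 < 1 - t by rewrite subr_gt0.
set K := C / (1 - t); have K0 : 0 <= K by rewrite divr_ge0// ltW.
(* This stronger bound telescopes, so that the induction on [k] goes through. *)
apply: (@le_trans _ _ (K * (t ^+ n - t ^+ (n + k)))); last first.
  by rewrite ler_wpM2l// gerBl exprn_ge0.
elim: k => [|k IH]; first by rewrite addn0 !subrr l2norm0 mulr0.
apply: le_trans (l2normB _ (u (n + k)%N) _) _; rewrite addnS.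
apply: le_trans (lerD (hu _) IH) _; rewrite exprS /K.
by rewrite le_eqVlt; apply/orP; left; apply/eqP; field; rewrite gt_eqF.
Qed.

(** Coordinates converge by completeness of the reals. Letting [m] tend to infinity in the bound on
    [u n - u m], over each finite set of coordinates, bounds the distance to the limit. *)
Lemma L2_complete (u : nat -> H) (C t : R) : 0 <= C -> 0 <= t < 1 ->
  (forall n, l2norm (u n.+1 - u n) <= C * t ^+ n) ->
  exists l : H, forall n, l2norm (u n - l) <= C / (1 - t) * t ^+ n.
Proof.
move=> C0 t01 hu; have ht := geometric_tail C0 t01 hu.
set K := C / (1 - t) in ht *.
have K0 : 0 <= K by rewrite divr_ge0// subr_ge0 ltW//; case/andP: t01.
have val_le x n k : cnorm (u (n + k)%N x - u n x) <= K * t ^+ n.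
  exact: le_trans (cnorm_le_l2norm (u (n + k)%N - u n) x) (ht n k).
have cre x : cvg ((fun n => complex.Re (u n x)) @ \oo).
  apply: (@geometric_cauchy_cvg _ _ K t) => // n k; apply: le_trans (val_le x n k).
  by case: (reim_le (u (n + k)%N x - u n x)); case: (u _ x) (u n x) => ? ? [].
have cim x : cvg ((fun n => complex.Im (u n x)) @ \oo).
  apply: (@geometric_cauchy_cvg _ _ K t) => // n k; apply: le_trans (val_le x n k).
  by case: (reim_le (u (n + k)%N x - u n x)); case: (u _ x) (u n x) => ? ? [].
pose l x : R[i] := lim ((fun n => complex.Re (u n x)) @ \oo) +i*
                   lim ((fun n => complex.Im (u n x)) @ \oo).
have nrm2 (z : R[i]) : cnorm z ^+ 2 = complex.Re z ^+ 2 + complex.Im z ^+ 2.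
  by case: z => a b /=; rewrite sqr_sqrtr// addr_ge0// sqr_ge0.
have cn x n : cnorm (u n x - u m x) ^+ 2 @[m --> \oo] --> cnorm (u n x - l x) ^+ 2.
  rewrite nrm2.
  have -> : (fun m => cnorm (u n x - u m x) ^+ 2) = (fun m =>
     (complex.Re (u n x) - complex.Re (u m x)) ^+ 2 + (complex.Im (u n x) - complex.Im (u m x))
       ^+ 2).
    by apply/funext => m; rewrite nrm2; case: (u n x) (u m x) => ? ? [].
  have -> : complex.Re (u n x - l x) = complex.Re (u n x) - lim ((fun n => complex.Re (u n x))
    @ \oo).
    by rewrite /l; case: (u n x).
  have -> : complex.Im (u n x - l x) = complex.Im (u n x) - lim ((fun n => complex.Im (u n x))
    @ \oo).
    by rewrite /l; case: (u n x).
  have hr : complex.Re (u n x) - complex.Re (u m x) @[m --> \oo] -->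
      complex.Re (u n x) - lim ((fun n => complex.Re (u n x)) @ \oo).
    by apply: cvgB; [exact: cvg_cst|exact: cre].
  have hi : complex.Im (u n x) - complex.Im (u m x) @[m --> \oo] -->
      complex.Im (u n x) - lim ((fun n => complex.Im (u n x)) @ \oo).
    by apply: cvgB; [exact: cvg_cst|exact: cim].
  exact: cvgD (cvgM hr hr) (cvgM hi hi).
have tp n : 0 <= K * t ^+ n by rewrite mulr_ge0 ?exprn_ge0//; case/andP: t01.
have bound n : (\esum_(x in [set: T]) (cnorm (u n x - l x) ^+ 2)%:E <= ((K * t ^+ n) ^+ 2)%:E)%E.
  apply: ge_ereal_sup => _ [F [Ffin _] <-].
  rewrite fsbig_finite//= sumEFin lee_fin.
  have cs : \sum_(x <- finmap.enum_fset (fset_set F)) cnorm (u n x - u m x) ^+ 2 @[m --> \oo] -->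
      \sum_(x <- finmap.enum_fset (fset_set F)) cnorm (u n x - l x) ^+ 2.
    by apply: cvg_big => //=; exact: add_continuous.
  apply: (cvgr_to_le cs); exists n => // m /= nm.
  rewrite -lee_fin -sumEFin; apply: (@le_trans _ _ (l2norm (u n - u m) ^+ 2)%:E); last first.
    rewrite lee_fin l2norm_distC -(subnKC nm).
    by rewrite ler_pXn2r ?nnegrE ?l2norm_ge0.
  rewrite l2norm_sqrE; apply: esum_ge; exists F; first by split.
  by rewrite fsbig_finite.
(* The pointwise limit [l] is not yet known to be in l2, but [u 0 - l] is; the limit is therefore
   taken to be [u 0 - d]. *)
have l0 : Lp 2 (fun x => u 0%N x - l x) by exact: le_lt_trans (bound 0%N) (ltry _).
pose d : H := MkL2 (asboolT l0).
exists (u 0%N - d) => n.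
have E x : (u n - (u 0%N - d)) x = u n x - l x.
  by rewrite -[LHS]/(u n x - (u 0%N x - (u 0%N x - l x))) subKr.
rewrite -(@ler_pXn2r _ 2)// ?nnegrE ?l2norm_ge0// -lee_fin l2norm_sqrE.
by rewrite (eq_esum (b := fun x => (cnorm (u n x - l x) ^+ 2)%:E))// => x _; rewrite E.
Qed.

End L2_hilbert.

(** * Polynomial functional calculus and the spectrum *)

Section polynomial_calculus.
Variables (R : realType) (G : groupType) (A : vN R G).
Local Notation H := (L2 R G).
Implicit Types (u v w : H) (p q : {poly R}) (P Q : {poly R[i]}).

(** Complex coefficients allow a polynomial to be split into linear factors. *)
Definition cpoly_op (p : {poly R[i]}) v : H := \sum_(i < size p) p`_i *: iter i A v.

Let cpoly_op_widen n (p : {poly R[i]}) v : (size p <= n)%N ->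
  cpoly_op p v = \sum_(i < n) p`_i *: iter i A v.
Proof.
move=> pn; rewrite /cpoly_op (big_ord_widen n (fun i => p`_i *: iter i A v) pn).
rewrite big_mkcond /=; apply: eq_bigr => i _; case: ltnP => // pi.
by rewrite nth_default// scale0r.
Qed.

Lemma cpoly_op_is_linear P : linear (cpoly_op P).
Proof.
move=> c u v; rewrite /cpoly_op scaler_sumr -big_split /=; apply: eq_bigr => i _.
have -> : iter i A (c *: u + v) = c *: iter i A u + iter i A v.
  by elim: (i : nat) => //= k ->; rewrite linearP.
by rewrite scalerDr !scalerA mulrC.
Qed.

Lemma cpoly_opD P Q v : cpoly_op (P + Q) v = cpoly_op P v + cpoly_op Q v.
Proof.
rewrite !(@cpoly_op_widen (maxn (size P) (size Q))) ?leq_maxl ?leq_maxr ?size_polyD//.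
by rewrite -big_split /=; apply: eq_bigr => i _; rewrite coefD scalerDl.
Qed.

Lemma cpoly_opZ c P v : cpoly_op (c *: P) v = c *: cpoly_op P v.
Proof.
rewrite (@cpoly_op_widen (size P)) ?size_scale_leq// scaler_sumr.
by apply: eq_bigr => i _; rewrite coefZ scalerA.
Qed.

Lemma cpoly_opC c v : cpoly_op c%:P v = c *: v.
Proof.
by rewrite (@cpoly_op_widen 1) ?size_polyC_leq1// big_ord1 coefC.
Qed.

Lemma cpoly_opMX P v : cpoly_op (P * 'X) v = cpoly_op P (A v).
Proof.
rewrite (@cpoly_op_widen (size P).+1); last first.
  by have [->|p0] := eqVneq P 0; rewrite ?mul0r ?size_poly0// size_mulX.
rewrite big_ord_recl coefMX scale0r add0r.
by apply: eq_bigr => i _; rewrite coefMX -iterSr.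
Qed.

Lemma cpoly_opX v : cpoly_op 'X v = A v.
Proof. by rewrite -['X]mul1r cpoly_opMX (cpoly_opC 1) scale1r. Qed.

Lemma cpoly_op_comm P v : cpoly_op P (A v) = A (cpoly_op P v).
Proof.
by rewrite /cpoly_op linear_sum; apply: eq_bigr => i _; rewrite linearZ /= -iterS iterSr.
Qed.

Lemma cpoly_opM P Q v : cpoly_op (P * Q) v = cpoly_op P (cpoly_op Q v).
Proof.
elim/poly_ind: P v => [|P c IH] v; first by rewrite mul0r !(cpoly_opC 0) !scale0r.
rewrite mulrDl -mulrA -(commr_polyX Q) mulrA !cpoly_opD !cpoly_opMX IH cpoly_op_comm.
by rewrite mul_polyC cpoly_opZ cpoly_opC.
Qed.

Lemma poly_opE p v : poly_op p A v = cpoly_op (map_poly (real_complex R) p) v.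
Proof.
rewrite /poly_op /cpoly_op size_map_poly; apply: eq_bigr => i _.
by rewrite coef_map.
Qed.

Lemma poly_op_is_linear p : linear (poly_op p A).
Proof. by move=> c u v; rewrite !poly_opE cpoly_op_is_linear. Qed.

Lemma poly_opD p q v : poly_op (p + q) A v = poly_op p A v + poly_op q A v.
Proof. by rewrite !poly_opE rmorphD cpoly_opD. Qed.

Lemma poly_opZ c p v : poly_op (c *: p) A v = c%:C *: poly_op p A v.
Proof. by rewrite !poly_opE map_polyZ cpoly_opZ. Qed.

Lemma poly_opN p v : poly_op (- p) A v = - poly_op p A v.
Proof. by rewrite -scaleN1r poly_opZ rmorphN rmorph1 scaleN1r. Qed.

Lemma poly_opM p q v : poly_op (p * q) A v = poly_op p A (poly_op q A v).
Proof. by rewrite !poly_opE rmorphM cpoly_opM. Qed.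

Lemma poly_opBr p u v : poly_op p A (u - v) = poly_op p A u - poly_op p A v.
Proof. by rewrite [u - v]addrC -scaleN1r poly_op_is_linear scaleN1r addrC. Qed.

Lemma poly_opC c v : poly_op c%:P A v = c%:C *: v.
Proof. by rewrite poly_opE map_polyC cpoly_opC. Qed.

Lemma poly_op1 v : poly_op 1 A v = v.
Proof. by rewrite poly_opC scale1r. Qed.

Lemma poly_opX v : poly_op 'X A v = A v.
Proof. by rewrite poly_opE map_polyX cpoly_opX. Qed.

Lemma poly_op_left_shift p g v : poly_op p A (left_shift g v) = left_shift g (poly_op p A v).
Proof.
have sP c u w : left_shift g (c *: u + w) = c *: left_shift g u + left_shift g w.
  exact/val_inj/funext.
have s0 : left_shift g (0 : H) = 0 by exact/val_inj/funext.
elim/poly_ind: p v => [|p c IH] v; first by rewrite !(poly_opC 0) !scale0r s0.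
rewrite !poly_opD !poly_opM !poly_opX !poly_opC vN_left_shift IH addrC.
by rewrite [in RHS]addrC sP.
Qed.

Lemma poly_op_bounded p : exists M, 0 <= M /\ forall v, l2norm (poly_op p A v) <= M * l2norm v.
Proof.
have [N hN] := vN_bounded A.
elim/poly_ind: p => [|p c [M [M0 hM]]].
  by exists 0; split=> // v; rewrite (poly_opC 0) scale0r l2norm0 mul0r.
exists (M * `|N| + `|c|); split=> [|v]; first by rewrite addr_ge0// mulr_ge0.
rewrite poly_opD poly_opM poly_opX poly_opC; apply: le_trans (l2normD _ _) _.
rewrite l2normZr mulrDl lerD2r; apply: le_trans (hM _) _.
rewrite -mulrA ler_wpM2l//; apply: le_trans (hN v) _.
by rewrite ler_wpM2r ?l2norm_ge0// ler_norm.
Qed.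

Lemma l2norm_left_shift g v : l2norm (left_shift g v) = l2norm v.
Proof.
rewrite /l2norm; congr (Num.sqrt (fine _)).
by rewrite [RHS](esum_bij _ (bij_mull g^-1%g)).
Qed.

(** Used to pass identities to norm limits: linearity, commutation with shifts, inverse
    relations. *)
Lemma geometric_eq u v (K t : R) : 0 <= t < 1 ->
  (forall n, l2norm (u - v) <= K * t ^+ n) -> u = v.
Proof.
move=> t01 h; apply/eqP; rewrite -subr_eq0; apply: contraT => /l2norm_gt0 e0.
have [N hN] := geometric_small K t01 e0.
by have := le_lt_trans (h N) (hN N (leqnn N)); rewrite ltxx.
Qed.

(** Completeness gives a pointwise limit, which inherits linearity and commutation with shifts;
    comparison with [p 0] bounds it. The explicit rate is what later makes estimates uniform over
    the quotients. *)
Lemma poly_op_geometric_limit (p : nat -> {poly R}) (C t : R) : 0 <= C -> 0 <= t < 1 ->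
  (forall n v, l2norm (poly_op (p n.+1) A v - poly_op (p n) A v) <= C * t ^+ n * l2norm v) ->
  exists B : vN R G, forall n v,
    l2norm (poly_op (p n) A v - B v) <= C / (1 - t) * t ^+ n * l2norm v.
Proof.
move=> C0 t01 hp.
have [b hb] : {b : H -> H & forall v n,
    l2norm (poly_op (p n) A v - b v) <= C / (1 - t) * t ^+ n * l2norm v}.
  apply: (@choice _ _ (fun v l => forall n,
    l2norm (poly_op (p n) A v - l) <= C / (1 - t) * t ^+ n * l2norm v)) => v.
  have [||l hl] := @L2_complete _ _ (fun n => poly_op (p n) A v) (C * l2norm v) t _ t01.
  - by rewrite mulr_ge0// l2norm_ge0.
  - by move=> n; rewrite mulrAC hp.
  by exists l => n; rewrite mulrAC [_ * l2norm v]mulrAC hl.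
have blin : linear b.
  move=> c u v.
  apply: (@geometric_eq _ _ (C / (1 - t) * l2norm (c *: u + v) +
     (cnorm c * (C / (1 - t) * l2norm u) + C / (1 - t) * l2norm v)) t t01) => n.
  apply: le_trans (l2normB _ (poly_op (p n) A (c *: u + v)) _) _.
  rewrite mulrDl l2norm_distC lerD//; first by rewrite mulrAC hb.
  rewrite poly_op_is_linear opprD addrACA -scalerBr; apply: le_trans (l2normD _ _) _.
  rewrite l2normZ mulrDl lerD//; last by rewrite mulrAC hb.
  by rewrite -[leRHS]mulrA ler_wpM2l ?cnorm_ge0// mulrAC hb.
pose bl := GRing.isLinear.Build R[i] H H *:%R b blin.
pose bL : {linear H -> H} := HB.pack b bl.
have bbd : exists M : R, forall v, l2norm (bL v) <= M * l2norm v.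
  have [M [M0 hM]] := poly_op_bounded (p 0%N).
  exists (C / (1 - t) + M) => v; rewrite -[bL v]subr0 mulrDl.
  apply: le_trans (l2normB _ (poly_op (p 0%N) A v) _) _; rewrite subr0 lerD//.
  by rewrite l2norm_distC; have := hb v 0%N; rewrite expr0 mulr1.
have bsh (g : G) v : bL (left_shift g v) = left_shift g (bL v).
  have sB u w : left_shift g u - left_shift g w = left_shift g (u - w).
    exact/val_inj/funext.
  apply: (@geometric_eq _ _ (C / (1 - t) * l2norm v + C / (1 - t) * l2norm v) t t01) => n.
  apply: le_trans (l2normB _ (poly_op (p n) A (left_shift g v)) _) _.
  rewrite mulrDl l2norm_distC lerD//.
    by rewrite mulrAC -(l2norm_left_shift g v) hb.
  by rewrite poly_op_left_shift sB l2norm_left_shift mulrAC hb.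
by exists (MkVN bbd bsh) => n v; exact: hb.
Qed.

End polynomial_calculus.

(** * The real spectrum of a symmetric operator *)

Section spectrum.
Variables (R : realType) (G : groupType) (A : vN R G).
Local Notation H := (L2 R G).
Implicit Types (u v w : H) (p q : {poly R}) (z : R[i]).

(** A weak form of invertibility of [A - z] that passes to products of linear factors; where it
    fails, [z] is in the spectrum. *)
Definition bounded_below z : Prop :=
  exists2 e : R, 0 < e & forall v, e * l2norm v <= l2norm (A v - z *: v).

(** The inverse [B] of [A - z] is bounded, and [v = B ((A - z) v)]. *)
Lemma bounded_below_resolvent z : ~ vN_spectrum A z -> bounded_below z.
Proof.
move=> /contrapT [B [BK _]]; have [M hM] := vN_bounded B.
have M0 : 0 < `|M| + 1 by rewrite ltr_wpDl.
exists (`|M| + 1)^-1; first by rewrite invr_gt0.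
move=> v; rewrite mulrC ler_pdivrMr// mulrC -{1}(BK v); apply: le_trans (hM _) _.
by rewrite ler_wpM2r ?l2norm_ge0// (le_trans (ler_norm M)) ?lerDl.
Qed.

Lemma cpoly_op_prod_bounded_below (s : seq R[i]) : (forall z, z \in s -> bounded_below z) ->
  exists2 e : R, 0 < e & forall v,
    e * l2norm v <= l2norm (cpoly_op A (\prod_(z <- s) ('X - z%:P)) v).
Proof.
elim: s => [_|z s IH hs].
  by exists 1 => // v; rewrite big_nil (cpoly_opC A 1) scale1r mul1r.
have [|e e0 he] := IH; first by move=> y ys; apply: hs; rewrite inE ys orbT.
have [d d0 hd] := hs z (mem_head _ _).
exists (d * e) => [|v]; first by rewrite mulr_gt0.
rewrite big_cons cpoly_opM -polyCN cpoly_opD cpoly_opC cpoly_opX.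
rewrite scaleNr; apply: le_trans (hd _).
by rewrite -mulrA; apply: ler_wpM2l; [exact: ltW|exact: he].
Qed.

Hypothesis Asym : forall v w, rinner (A v) w = rinner v (A w).

Lemma poly_op_sym p v w : rinner (poly_op p A v) w = rinner v (poly_op p A w).
Proof.
elim/poly_ind: p v w => [|p c IH] v w.
  by rewrite !(poly_opC A 0) -[0 *: v]/(0%:C *: v) -[0 *: w]/(0%:C *: w) rinnerZl rinnerZr !mul0r.
rewrite !poly_opD !poly_opM !poly_opX !poly_opC rinnerDl rinnerDr rinnerZl rinnerZr IH Asym.
by congr (rinner _ _ + _); rewrite -!poly_opX -!poly_opM mulrC.
Qed.

(** With [S = A - a] symmetric, [S v] and ['i *: v] are orthogonal for [rinner], so
    [|(A - z) v|^2 = |S v|^2 + b^2 |v|^2] for [z = a + i b]. *)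
Lemma bounded_below_nonreal (a b : R) : b != 0 -> bounded_below (a +i* b).
Proof.
move=> b0; exists `|b|; first by rewrite normr_gt0.
move=> v; pose S u := A u - a%:C *: u.
have Ssym u w : rinner (S u) w = rinner u (S w).
  by rewrite /S !(rinnerDl, rinnerDr, rinnerNl, rinnerNr, rinnerZl, rinnerZr) Asym.
have Si u : S ('i *: u) = 'i *: S u.
  by rewrite /S linearZ /= scalerBr !scalerA mulrC.
(* The number equals its own opposite, by symmetry of [S] and skewness of ['i]. *)
have SJ : rinner (S v) ('i *: v) = 0.
  have : rinner (S v) ('i *: v) = - rinner (S v) ('i *: v).
    by rewrite {1}Ssym Si (rinnerC (S v)) rinner_i opprK.
  by move/eqP; rewrite -addr_eq0 -mulr2n mulrn_eq0 => /eqP.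
have E : A v - (a +i* b) *: v = S v - b%:C *: ('i *: v).
  rewrite /S scalerA -addrA -opprD -scalerDl; congr (_ - _ *: _).
  by apply/eqP; rewrite eq_complex /=; apply/andP; split; apply/eqP; ring.
have iv : l2norm ('i *: v) = l2norm v.
  by rewrite l2normZ /= expr0n/= add0r expr1n sqrtr1 mul1r.
rewrite -(@ler_pXn2r _ 2)// ?nnegrE ?mulr_ge0 ?l2norm_ge0// exprMn E {E Ssym Si}.
set w := 'i *: v in SJ iv *; clearbody S w.
rewrite [leRHS]l2norm_sqrB l2normZr rinnerZr SJ iv [in leRHS]exprMn real_normK ?num_real//.
by have := sqr_ge0 (l2norm (S v)); lra.
Qed.

Lemma spectrum_of_not_bounded_below z : ~ bounded_below z ->
  exists2 x : R, z = x%:C & vN_spectrum A x%:C.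
Proof.
case: z => a b nb; have b0 : b = 0.
  by apply/eqP; apply: contraT => b0; case: nb; exact: bounded_below_nonreal.
by rewrite b0 in nb *; exists a => //; apply: contrapT => /bounded_below_resolvent.
Qed.

(** Over the complex numbers [q] splits; if [A - z] were bounded below for every root [z], so would
    be [q(A)]. A root where this fails is real and in the spectrum. *)
Lemma spectrum_root q : q != 0 ->
  ~ (exists2 e : R, 0 < e & forall v, e * l2norm v <= l2norm (poly_op q A v)) ->
  exists2 x : R, vN_spectrum A x%:C & root q x.
Proof.
move=> q0 nb; pose Q := map_poly (real_complex R) q.
have Q0 : Q != 0 by rewrite map_poly_eq0.
have [s Qs] := closed_field_poly_normal Q.
have [[z [zs nz]]|all_s] := pselect (exists z, z \in s /\ ~ bounded_below z).
  have [x zx sx] := spectrum_of_not_bounded_below nz; exists x => //.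
  have : root Q z by rewrite Qs rootZ ?lead_coef_eq0// root_prod_XsubC.
  by rewrite zx fmorph_root.
case: nb; have [|e e0 he] := @cpoly_op_prod_bounded_below s.
  by move=> z zs; apply: contrapT => nz; case: all_s; exists z.
have c0 : 0 < cnorm (lead_coef Q).
  rewrite lt_def cnorm_ge0 andbT; apply/eqP => /ComplexField.Normc.eq0_normc /eqP.
  by rewrite lead_coef_eq0 (negbTE Q0).
exists (cnorm (lead_coef Q) * e) => [|v]; first by rewrite mulr_gt0.
by rewrite poly_opE -/Q [in leRHS]Qs cpoly_opZ l2normZ -mulrA ler_pM2l.
Qed.

Lemma e1_neq0 : e1 R G != 0.
Proof.
apply/eqP => /(congr1 (fun v : H => v 1%g)) /=; rewrite /dirac1 eqxx => /eqP.
by rewrite oner_eq0.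
Qed.

(** Here [m] is the squared norm of [T = q(A)]. If [m - T^2] were bounded below by [e], expanding
    [|(m - T^2) v|^2] would make [m - e^2 / m] a smaller bound for [|T v|^2 / |v|^2]. *)
Lemma poly_op_norm_attained q : exists m : R,
  (forall v, l2norm (poly_op q A v) ^+ 2 <= m * l2norm v ^+ 2) /\
  ~ (exists2 e : R, 0 < e & forall v, e * l2norm v <= l2norm (poly_op (m%:P - q ^+ 2) A v)).
Proof.
have [M [M0 hM]] := poly_op_bounded A q.
pose T v := poly_op q A v.
have T0 v : 0 <= l2norm (T v) ^+ 2 by exact: sqr_ge0.
pose S := [set m | forall v, l2norm (T v) ^+ 2 <= m * l2norm v ^+ 2].
have SM : S (M ^+ 2).
  by move=> v; rewrite -exprMn ler_pXn2r ?nnegrE ?mulr_ge0 ?l2norm_ge0// hM.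
have S_lb v : l2norm v != 0 -> lbound S (l2norm (T v) ^+ 2 / l2norm v ^+ 2).
  move=> v0 m /(_ v) h; rewrite ler_pdivrMr// exprn_gt0// lt_def v0 l2norm_ge0//.
(* A nonzero vector is needed to bound [S] from below. *)
have e1n : l2norm (e1 R G) != 0 by rewrite gt_eqF// l2norm_gt0// e1_neq0.
have Sinf : has_inf S by split; [exists (M ^+ 2)|exists (l2norm (T (e1 R G)) ^+ 2 / l2norm (e1
  R G) ^+ 2); exact: S_lb].
pose m := inf S; have Sm : S m.
  move=> v; have [v0|v0] := eqVneq (l2norm v) 0.
    by have := SM v; rewrite v0 expr0n/= !mulr0.
  rewrite -ler_pdivrMr ?exprn_gt0 ?lt_def ?v0 ?l2norm_ge0//.
  by apply: lb_le_inf; [exists (M ^+ 2)|exact: S_lb].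
exists m; split=> // -[e e0 he].
have m0 : 0 <= m.
  rewrite -(pmulr_lge0 _ (_ : 0 < l2norm (e1 R G) ^+ 2)); last first.
    by rewrite exprn_gt0// lt_def e1n l2norm_ge0.
  exact: le_trans (T0 _) (Sm _).
(* Combines [<v, T (T v)> = |T v|^2] with [|T (T v)|^2 <= m |T v|^2]. *)
have key v : m * l2norm (T v) ^+ 2 <= (m ^+ 2 - e ^+ 2) * l2norm v ^+ 2.
  have h1 : (e * l2norm v) ^+ 2 <= l2norm (m%:C *: v - T (T v)) ^+ 2.
    rewrite ler_pXn2r ?nnegrE ?mulr_ge0 ?l2norm_ge0 ?(ltW e0)//.
    by have := he v; rewrite poly_opD poly_opN poly_opC expr2 poly_opM.
  move: h1; rewrite exprMn [leRHS]l2norm_sqrB l2normZr rinnerZl exprMn real_normK ?num_real//.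
  rewrite -(poly_op_sym q v (T v)) -/(T v) -l2norm_sqr.
  by have := Sm (T v); lra.
(* For [m = 0] one cannot divide by [m], but [key] at [e1] is already contradictory. *)
have [mz|mz] := eqVneq m 0.
  have := key (e1 R G); rewrite mz mul0r expr0n /= sub0r mulNr oppr_ge0 leNgt.
  by rewrite mulr_gt0 ?exprn_gt0// lt_def e1n l2norm_ge0.
have mp : 0 < m by rewrite lt_def mz.
have : S (m - e ^+ 2 / m).
  move=> v; rewrite -(ler_pM2l mp); apply: le_trans (key v) _.
  by rewrite le_eqVlt; apply/orP; left; apply/eqP; field.
move/(ge_inf Sinf.2); rewrite -/m lerBDr gerDl leNgt => /negP; apply.
by rewrite divr_gt0// exprn_gt0.
Qed.

(** For [q = 'X] the polynomial [m - 'X^2] is nonzero, so [spectrum_root] yields a point. *)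
Lemma spectrum_neq0 : exists x : R, vN_spectrum A x%:C.
Proof.
have [m [_ nb]] := poly_op_norm_attained 'X.
have [|x sx _] := spectrum_root _ nb; last by exists x.
apply/eqP => /(congr1 (fun p : {poly R} => p`_2)) /eqP.
by rewrite coefB coefC coefXn coef0 sub0r oppr_eq0 oner_eq0.
Qed.

(** The squared norm of [q(A)] equals [q(x)^2] at some [x] of the real spectrum. *)
Lemma poly_op_spectral_bound q (c : R) :
  (forall x : R, vN_spectrum A x%:C -> `|q.[x]| <= c) ->
  forall v, l2norm (poly_op q A v) <= c * l2norm v.
Proof.
move=> hc; have [m [hm nb]] := poly_op_norm_attained q.
have [x sx qx] : exists2 x : R, vN_spectrum A x%:C & root (m%:P - q ^+ 2) x.
  (* If [m - q^2] vanishes identically, any point of the spectrum serves. *)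
  have [z|nz] := eqVneq (m%:P - q ^+ 2) 0; last exact: spectrum_root.
  by have [x sx] := spectrum_neq0; exists x => //; rewrite z root0.
have c0 : 0 <= c by exact: le_trans (hc x sx).
have mE : m = q.[x] ^+ 2.
  by move: qx; rewrite rootE !hornerE subr_eq0 => /eqP.
move=> v; rewrite -(@ler_pXn2r _ 2)// ?nnegrE ?mulr_ge0 ?l2norm_ge0//.
apply: le_trans (hm v) _; rewrite exprMn ler_wpM2r ?sqr_ge0// mE.
by rewrite -(real_normK (num_real q.[x])) ler_pXn2r ?nnegrE// hc.
Qed.

End spectrum.

(** * The logarithm as a power series *)

Section logarithm_series.
Variables (R : realType) (b : R).
Hypothesis b0 : 0 < b.
Implicit Types (t d : R) (n : nat).

Definition one_minus : {poly R} := 1 - b^-1 *: 'X.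

(** The Taylor polynomial of [ln] at [b], of degree [n]. *)
Definition log_poly n : {poly R} :=
  (ln b)%:P - \sum_(k < n) k.+1%:R^-1 *: one_minus ^+ k.+1.

Lemma log_polyS n : log_poly n.+1 = log_poly n - n.+1%:R^-1 *: one_minus ^+ n.+1.
Proof. by rewrite /log_poly big_ord_recr /= opprD addrA. Qed.

Lemma horner_one_minus t : one_minus.[t] = 1 - t / b.
Proof. by rewrite /one_minus !hornerE mulrC. Qed.

(** The derivative of [log_poly n] is a geometric sum, with value [(1 - (1 - t/b)^n) / t]; the
    induction adds one term at a time. *)
Lemma is_derive_log_rem n t : 0 < t ->
  is_derive t (1 : R) (fun t => ln t - (log_poly n).[t]) (t^-1 * (1 - t / b) ^+ n).
Proof.
move=> t0; have tn0 : t != 0 by rewrite gt_eqF.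
have bn0 : b != 0 by rewrite gt_eqF.
elim: n => [|n IH].
  have -> : (fun t => ln t - (log_poly 0).[t]) = (@ln R : R -> R) - cst (ln b).
    by apply/funext => x; rewrite /log_poly big_ord0 subr0 hornerC.
  have h := is_derive1_ln t0.
  by apply: is_derive_eq; rewrite subr0 expr0 mulr1.
pose y : R -> R := cst 1 - b^-1 *: id.
have -> : (fun t => ln t - (log_poly n.+1).[t]) =
    (fun t => ln t - (log_poly n).[t]) + n.+1%:R^-1 *: y ^+ n.+1.
  apply/funext => x; rewrite log_polyS hornerD hornerN hornerZ horner_exp horner_one_minus.
  rewrite opprD opprK addrA; congr (_ + _ * _).
  have -> : (y ^+ n.+1) x = y x ^+ n.+1 by elim: n.+1 {IH} => // m; rewrite !exprS => <-.
  by congr (_ ^+ _); rewrite /y /= mulrC.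
have hy : is_derive t (1 : R) y (- b^-1).
  by apply: is_derive_eq; rewrite sub0r /GRing.scale /= mulr1.
apply: (is_derive_eq (is_deriveD IH (is_deriveZ n.+1%:R^-1 (is_deriveX n.+1 hy)))).
rewrite (_ : y t = 1 - t / b); last by rewrite /y /= mulrC.
rewrite /GRing.scale /= -mulr_natr exprS; set z := 1 - t / b.
have n1 : n.+1%:R != 0 :> R by rewrite pnatr_eq0.
have -> : t^-1 * (z * z ^+ n) = t^-1 * z ^+ n + z ^+ n * - b^-1.
  by rewrite /z; field; rewrite bn0 tn0.
congr (_ + _); field; by rewrite bn0 nat1r n1.
Qed.

(** The remainder vanishes at [b], its derivative is at most [d^n / (b (1 - d))] in modulus wherever
    [|1 - t/b| <= d], and [|t - b| <= d b]; the mean value theorem concludes. *)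
Lemma log_poly_approx n d t : 0 <= d < 1 -> `|1 - t / b| <= d ->
  `|ln t - (log_poly n).[t]| <= d / (1 - d) * d ^+ n.
Proof.
move=> /andP[d0 d1] td; have d1' : 0 < 1 - d by rewrite subr_gt0.
have dlo x : `|1 - x / b| <= d -> b * (1 - d) <= x.
  by rewrite ler_norml => /andP[_]; rewrite lerBlDr -lerBlDl ler_pdivlMr// mulrC.
have dpos x : `|1 - x / b| <= d -> 0 < x.
  by move/dlo; apply: lt_le_trans; rewrite mulr_gt0.
pose g t := ln t - (log_poly n).[t]; pose dg t := t^-1 * (1 - t / b) ^+ n.
have gb : g b = 0.
  rewrite /g /log_poly hornerD hornerC hornerN horner_sum big1 ?subr0 ?subrr// => k _.
  by rewrite hornerZ horner_exp horner_one_minus divff ?gt_eqF// subrr expr0n mulr0.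
have bd : `|1 - b / b| <= d by rewrite divff ?gt_eqF// subrr normr0.
have dgle x : `|1 - x / b| <= d -> `|dg x| <= d ^+ n / (b * (1 - d)).
  move=> xd; rewrite /dg normrM normrX mulrC ler_pM ?exprn_ge0//.
    by rewrite lerXn2r ?nnegrE.
  rewrite normfV gtr0_norm ?dpos// lef_pV2 ?posrE ?dlo ?mulr_gt0//.
  exact: dpos.
have tb : `|t - b| <= d * b.
  rewrite -ler_pdivrMr//; apply: le_trans td; rewrite -[leLHS]ger0_norm ?divr_ge0 ?(ltW b0)//.
  rewrite normrM normr_id -normrM -normrN le_eqVlt; apply/orP; left; apply/eqP.
  by congr `|_|; field; rewrite gt_eqF.
have mvt (x y : R) : x <= y -> `|1 - x / b| <= d -> `|1 - y / b| <= d ->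
    exists2 c, `|1 - c / b| <= d & g y - g x = dg c * (y - x).
  move=> xy xd yd.
  have itvd z : x <= z <= y -> `|1 - z / b| <= d.
    move=> /andP[xz zy]; have xzb : x / b <= z / b by rewrite ler_pM2r ?invr_gt0.
    have zyb : z / b <= y / b by rewrite ler_pM2r ?invr_gt0.
    by move: xd yd; rewrite !ler_norml; lra.
  have [||c cxy E] := @MVT_segment R g dg x y xy.
  - move=> z; rewrite in_itv /= => /andP[xz zy].
    by apply: is_derive_log_rem; apply/dpos/itvd; rewrite !ltW.
  - apply: derivable_within_continuous => z; rewrite in_itv /= => zxy.
    by apply: ex_derive; apply: is_derive_log_rem; exact/dpos/itvd.
  by exists c => //; apply: itvd; move: cxy; rewrite in_itv.
have fin c : `|1 - c / b| <= d -> `|dg c| * `|t - b| <= d / (1 - d) * d ^+ n.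
  move=> cd; apply: le_trans (ler_pM (normr_ge0 _) (normr_ge0 _) (dgle _ cd) tb) _.
  by rewrite le_eqVlt; apply/orP; left; apply/eqP; field; rewrite !gt_eqF.
rewrite -/(g t); have [tb'|/ltW bt] := leP t b.
  have [c cd] := mvt _ _ tb' td bd; rewrite gb sub0r => /(congr1 Num.norm).
  by rewrite normrN normrM (distrC b t) => ->; exact: fin.
have [c cd] := mvt _ _ bt bd td; rewrite gb subr0 => /(congr1 Num.norm).
by rewrite normrM => ->; exact: fin.
Qed.

End logarithm_series.

Lemma uniform_cvgP (R : realType) (S : set R) (F : nat -> R -> R) (f : R -> R) :
  {uniform S, F @ \oo --> f} <->
  forall e, 0 < e -> exists N, forall n, (N <= n)%N -> forall x, S x -> `|f x - F n x| < e.
Proof.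
split=> [Ff e e0|h P /uniform_nbhs [E [entE sub]]].
  have [N _ hN] : \forall n \near \oo, forall x, S x -> `|f x - F n x| < e.
    apply: (Ff [set h | forall x, S x -> `|f x - h x| < e]); apply/uniform_nbhs.
    exists [set xy | ball xy.1 e xy.2]; split; first by rewrite -entourage_ballE; exists e.
    by move=> h hh x Sx; exact: hh.
  by exists N => n /hN.
move: entE; rewrite -entourage_ballE => -[e e0 eE].
have [N hN] := h e e0; exists N => // n /= Nn; apply: sub => x Sx.
by apply: eE; rewrite /= /ball /=; exact: hN.
Qed.

(** * The logarithm of an operator *)

Section logarithm.
Variables (R : realType) (G : groupType) (A : vN R G) (b d : R).
Local Notation H := (L2 R G).
Hypotheses (b0 : 0 < b) (d01 : 0 <= d < 1).
Hypothesis Ab : forall v, l2norm (poly_op (one_minus b) A v) <= d * l2norm v.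

Let d0 : 0 <= d. Proof. by case/andP: d01. Qed.

Let pow_le n v : l2norm (poly_op (one_minus b ^+ n) A v) <= d ^+ n * l2norm v.
Proof.
elim: n v => [|n IH] v; first by rewrite !expr0 poly_op1 mul1r.
rewrite !exprS poly_opM; apply: le_trans (Ab _) _.
by rewrite -mulrA ler_wpM2l.
Qed.

(** For [s = 1 - t/b] with [|s| > d], the operator [A - t = b (s - (1 - A/b))] is inverted by a
    Neumann series in [1 - A/b]. *)
Lemma spectrum_near (t : R) : vN_spectrum A t%:C -> `|1 - t / b| <= d.
Proof.
move=> spt; rewrite leNgt; apply/negP => ds; apply: spt.
set s := 1 - t / b in ds; have s0 : s != 0.
  by rewrite -normr_gt0 (le_lt_trans d0 ds).
have bn0 : b != 0 by rewrite gt_eqF.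
(* Partial sums of the Neumann series; [pE] gives their defect as inverses of ['X - t]. *)
pose p n : {poly R} := \sum_(k < n) (b^-1 * s ^- k.+1) *: one_minus b ^+ k.
have pE n : ('X - t%:P) * p n = 1 - s ^- n *: one_minus b ^+ n.
  have XE : 'X - t%:P = b *: (s%:P - one_minus b).
    apply/polyP => i; rewrite /one_minus !(coefB, coefN, coefZ, coefX, coefC, coef1).
    by case: i => [|[|i]] /=; rewrite /s; field.
  elim: n => [|n IH]; first by rewrite /p big_ord0 mulr0 !expr0 invr1 scale1r subrr.
  rewrite /p big_ord_recr /= -/(p n) mulrDr IH XE.
  rewrite -scalerAl -scalerAr scalerA mulrBl -exprS mul_polyC scalerBr scalerA.
  have -> : b * (b^-1 * s ^- n.+1) * s = s ^- n.
    by rewrite exprS; field; rewrite bn0 s0 expf_neq0.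
  by rewrite mulVKf// addrA subrK.
have sp : 0 < `|s| by rewrite normr_gt0.
have t01 : 0 <= d / `|s| < 1 by rewrite divr_ge0//= ltr_pdivrMr// mul1r.
pose C := (b * `|s|)^-1; have C0 : 0 <= C by rewrite invr_ge0 mulr_ge0// ltW.
have tail n v : l2norm (poly_op (s ^- n *: one_minus b ^+ n) A v) <= (d / `|s|) ^+ n * l2norm v.
  rewrite poly_opZ l2normZr normfV normrX expr_div_n [leRHS]mulrAC [leLHS]mulrC.
  by rewrite ler_wpM2r ?invr_ge0 ?exprn_ge0.
have [|B hB] := poly_op_geometric_limit (A := A) (p := p) C0 t01.
  move=> n v; rewrite -poly_opN -poly_opD /p big_ord_recr /= addrAC subrr add0r.
  rewrite poly_opZ l2normZr normrM (ger0_norm (_ : 0 <= b^-1)) ?invr_ge0 ?(ltW b0)//.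
  rewrite normfV normrX expr_div_n /C invfM exprS invfM.
  rewrite -![b^-1 * _ * _]mulrA -!mulrA ler_wpM2l ?invr_ge0 ?(ltW b0)//.
  rewrite ler_wpM2l ?invr_ge0// mulrCA ler_wpM2l ?invr_ge0 ?exprn_ge0//.
have At v : A v - t%:C *: v = poly_op ('X - t%:P) A v.
  by rewrite poly_opD poly_opX -polyCN poly_opC rmorphN scaleNr.
have pr n v : poly_op ('X - t%:P) A (poly_op (p n) A v) =
    v - poly_op (s ^- n *: one_minus b ^+ n) A v.
  by rewrite -poly_opM pE poly_opD poly_op1 poly_opN.
(* Both inverse relations hold for [p n] up to the geometric error [tail], and pass to the limit. *)
exists B; split=> v; rewrite At.
  apply: (@geometric_eq _ _ _ _ (C / (1 - d / `|s|) * l2norm (poly_op ('X - t%:P) A v) + l2norm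
    v) (d / `|s|)) => // n.
  apply: le_trans (l2normB _ (poly_op (p n) A (poly_op ('X - t%:P) A v)) _) _.
  rewrite mulrDl lerD//; first by rewrite l2norm_distC mulrAC hB.
  rewrite -poly_opM mulrC poly_opM pr [v - _]addrC addrK l2normN mulrC; exact: tail.
have [M [M0 hM]] := poly_op_bounded A ('X - t%:P).
apply: (@geometric_eq _ _ _ _ (M * (C / (1 - d / `|s|) * l2norm v) + l2norm v) (d / `|s|)) => // n.
apply: le_trans (l2normB _ (poly_op ('X - t%:P) A (poly_op (p n) A v)) _) _.
rewrite mulrDl lerD//; last by rewrite pr [v - _]addrC addrK l2normN mulrC; exact: tail.
rewrite -poly_opBr; apply: le_trans (hM _) _;
  rewrite -[leRHS]mulrA ler_wpM2l// l2norm_distC mulrAC; exact: hB.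
Qed.

(** Successive terms differ by [(1 - A/b)^(n+1) / (n+1)], of norm at most [d * d^n]. *)
Lemma log_poly_limit : exists B : vN R G, forall n v,
  l2norm (poly_op (log_poly b n) A v - B v) <= d / (1 - d) * d ^+ n * l2norm v.
Proof.
apply: poly_op_geometric_limit => // n v.
rewrite -poly_opN -poly_opD log_polyS addrAC subrr add0r poly_opN l2normN poly_opZ l2normZr.
rewrite -[leRHS]mul1r ler_pM//; first exact: l2norm_ge0.
  by rewrite normfV ger0_norm// invf_le1 ?ltr0n// ler1n.
by rewrite -exprS.
Qed.

Let log_rate (e : R) : 0 < e -> exists N, forall n, (N <= n)%N -> d / (1 - d) * d ^+ n < e.
Proof. exact: geometric_small. Qed.

Lemma is_funcalc_ln (B : vN R G) : (forall n v,
    l2norm (poly_op (log_poly b n) A v - B v) <= d / (1 - d) * d ^+ n * l2norm v) ->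
  is_funcalc (@ln R) A B.
Proof.
move=> hB; exists (log_poly b); split.
  apply/uniform_cvgP => e e0; have [N hN] := log_rate e0.
  exists N => n Nn x /spectrum_near xd; apply: le_lt_trans (hN n Nn).
  exact: log_poly_approx.
move=> e e0; have [N hN] := log_rate e0; exists N => // n /= Nn v.
by apply: le_trans (hB n v) _; rewrite ler_wpM2r ?l2norm_ge0// ltW// hN.
Qed.

Hypothesis Asym : forall v w, rinner (A v) w = rinner v (A w).

(** [vN_log A] is known only through some approximating polynomials [p]. On the spectrum [p m] and
    [log_poly b m] are both close to [ln], so the spectral bound makes them close at [A], and their
    limits agree. *)
Lemma vN_log_approx n v :
  l2norm (poly_op (log_poly b n) A v - vN_log A v) <= d / (1 - d) * d ^+ n * l2norm v.
Proof.
have [B hB] := log_poly_limit.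
(* The existence of [B] ensures that [xget] returns a logarithm and not its default. *)
have [p [/uniform_cvgP pln pL]] : is_funcalc (@ln R) A (vN_log A).
  by apply: (@xgetPex _ _ [set B | is_funcalc (@ln R) A B]); exists B; exact: is_funcalc_ln.
suff -> : vN_log A v = B v by exact: hB.
apply/eqP; rewrite -subr_eq0; apply: contraT => /l2norm_gt0 h0.
(* The errors will add up to [4 * e * l2norm v], which the factor 5 keeps below the distance; the
   added 1 avoids dividing by zero. *)
pose e := l2norm (vN_log A v - B v) / (5 * (l2norm v + 1)).
have v1 : 0 < l2norm v + 1 by rewrite ltr_wpDl ?l2norm_ge0.
have e0 : 0 < e by rewrite divr_gt0// mulr_gt0.
have [N1 h1] := pln e e0; have [N2 _ h2] := pL e e0; have [N3 h3] := log_rate e0.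
pose m := (N1 + N2 + N3)%N.
have m1 : (N1 <= m)%N by rewrite /m -addnA leq_addr.
have m2 : (N2 <= m)%N by rewrite /m addnAC leq_addl.
have m3 : (N3 <= m)%N by rewrite /m leq_addl.
have h4 : l2norm (poly_op (p m - log_poly b m) A v) <= 2 * e * l2norm v.
  apply: poly_op_spectral_bound => // x sx.
  have x1 := h1 m m1 x sx; have x2 := log_poly_approx b0 m d01 (spectrum_near sx).
  have x3 := h3 m m3; rewrite hornerD hornerN.
  rewrite (_ : _ - _ = (ln x - (log_poly b m).[x]) - (ln x - (p m).[x])); last by ring.
  by apply: le_trans (ler_normB _ _) _; lra.
have h5 := h2 m m2 v; have h6 := hB m v.
have h7 : l2norm (vN_log A v - B v) <= 4 * e * l2norm v.
  apply: le_trans (l2normB _ (poly_op (p m) A v) _) _.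
  apply: le_trans (lerD (lexx _) (l2normB _ (poly_op (log_poly b m) A v) _)) _.
  rewrite l2norm_distC; rewrite poly_opD poly_opN in h4.
  have h8 : d / (1 - d) * d ^+ m * l2norm v <= e * l2norm v.
    by rewrite ler_wpM2r ?l2norm_ge0// ltW// h3.
  by move: h4 h5 h6 h8; lra.
have : 4 * e * l2norm v < l2norm (vN_log A v - B v).
  rewrite /e; have := l2norm_ge0 v; move: h0 v1.
  set x := l2norm (_ - _); set y := l2norm v => x0 y1 y0.
  rewrite (_ : 4 * _ * y = x * (4 * y) / (5 * (y + 1))); last by field; rewrite gt_eqF.
  by rewrite ltr_pdivrMr ?mulr_gt0// ltr_pM2l//; lra.
by move/(le_lt_trans h7); rewrite ltxx.
Qed.

End logarithm.

(** * The operators rho f and the convergence of traces *)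

Section rho_adjoint.
Variables (R : realType) (G : groupType).
Local Notation H := (L2 R G).
Implicit Types (f h : L1 R G) (u v w : H).

Lemma l1_starK (w : G -> R[i]) : l1_star (l1_star w) = w.
Proof. by apply/funext => g; rewrite /l1_star invgK conjcK. Qed.

(** Convolution by [l1_star (l1_star f)] is an adjoint, so [xget] does not return its default. *)
Lemma vN_adj_rhoP f v w : inner (rho f v) w = inner v (vN_adj (rho f) w).
Proof.
pose B : vN R G := rho (MkL1 (l1_star_Lp1 (L1P f))).
have := @xgetPex _ (@vN_id R G) [set B : vN R G | forall v w, inner (rho f v) w = inner v (B w)].
apply; exists B => v' w'.
exact: (inner_convol (l1_star_Lp1 (L1P f))).
Qed.

(** Uniqueness of adjoints: the difference of two candidates at [w] is orthogonal to every vector,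
    hence to itself. *)
Lemma vN_adj_rho f w : vN_adj (rho f) w = convol w f :> (G -> R[i]).
Proof.
pose B : vN R G := rho (MkL1 (l1_star_Lp1 (L1P f))).
have BP v : inner (rho f v) w = inner v (B w).
  exact: (inner_convol (l1_star_Lp1 (L1P f))).
have -> : vN_adj (rho f) w = B w.
  apply/eqP; rewrite -subr_eq0; apply/eqP/l2norm_eq0/eqP; rewrite -sqrf_eq0 l2norm_sqr.
  by rewrite rinnerDr rinnerNr /rinner -BP -vN_adj_rhoP subrr.
exact: (congr1 (convol w) (l1_starK f)).
Qed.

Definition rho_rho_adj f : vN R G := vN_comp (rho f) (vN_adj (rho f)).

Lemma rho_rho_adjE f v :
  rho_rho_adj f v = convol (convol v f) (l1_star f) :> (G -> R[i]).
Proof. by rewrite -vN_adj_rho. Qed.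

Lemma rinner_rho_rho_adj f v w :
  rinner (rho_rho_adj f v) w = rinner (vN_adj (rho f) v) (vN_adj (rho f) w).
Proof. by rewrite /rinner -vN_adj_rhoP. Qed.

Lemma l2norm_convol u v (w : G -> R[i]) (B : R) : Lp 1 w -> 0 < B ->
  (l1norm w <= B%:E)%E -> u = convol v w :> (G -> R[i]) ->
  l2norm u <= 2 * B * l2norm v.
Proof.
move=> sw B0 wB uE; have B2 : 0 <= 2 * B by rewrite mulr_ge0// ltW.
rewrite -(@ler_pXn2r _ 2)// ?nnegrE ?(mulr_ge0 B2) ?l2norm_ge0//.
by rewrite -lee_fin exprMn (EFinM (_ ^+ 2) (_ ^+ 2)) !l2norm_sqrE uE; exact: young (L2P v) sw B0 wB.
Qed.

Lemma l2norm_e1 : l2norm (e1 R G) = 1.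
Proof.
apply: (@pexpIrn _ 2) => //; rewrite ?nnegrE ?l2norm_ge0// expr1n l2norm_sqr /rinner /inner.
rewrite (@csum_support _ _ _ 1%g) => [|x /negbTE x1] /=; rewrite /dirac1 ?x1 ?mul0r//.
by rewrite eqxx mul1r.
Qed.

Lemma inner_e1 v : inner v (e1 R G) = v 1%g.
Proof.
rewrite /inner (@csum_support _ _ _ 1%g) => [|x /negbTE x1] /=; rewrite /dirac1.
  by rewrite eqxx rmorph1 mulr1.
by rewrite x1 rmorph0 mulr0.
Qed.

(** The [k]-th convolution power of [f f^*], bracketed like the iterates of [rho_rho_adj f] on
    [e1]. *)
Definition ff_star_pow (f : G -> R[i]) k : G -> R[i] :=
  iter k (fun w : G -> R[i] => convol (convol w f) (l1_star f)) (@dirac1 R G).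

Lemma dirac1_Lp1 : Lp 1 (@dirac1 R G).
Proof.
apply/Lp1_l1norm; rewrite /l1norm (@esum_support _ _ _ 1%g) ?ltry// => x.
  by rewrite lee_fin cnorm_ge0.
by move=> /negbTE x1; rewrite /dirac1 x1 ComplexField.Normc.normc0.
Qed.

Lemma ff_star_pow_Lp1 (f : G -> R[i]) k : Lp 1 f -> Lp 1 (ff_star_pow f k).
Proof.
move=> sf; elim: k => [|k IH] /=; first exact: dirac1_Lp1.
by apply: convol_Lp1; [exact: convol_Lp1|exact: l1_star_Lp1].
Qed.

Lemma trace_poly_op f (p : {poly R}) :
  rinner (poly_op p (rho_rho_adj f) (e1 R G)) (e1 R G) =
  \sum_(i < size p) p`_i * complex.Re (ff_star_pow f i 1%g).
Proof.
have r0 : rinner 0 (e1 R G) = 0 by rewrite -(scale0r (0 : H)) -[0]/(0%:C) rinnerZl mul0r.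
rewrite /poly_op (big_morph (fun v => rinner v (e1 R G)) (fun u v => rinnerDl u v _) r0).
apply: eq_bigr => i _; rewrite rinnerZl; congr (_ * _); rewrite /rinner inner_e1.
congr (complex.Re (_ 1%g)); elim: (i : nat) => // k IH.
by rewrite /ff_star_pow !iterS rho_rho_adjE IH.
Qed.

End rho_adjoint.

Lemma push_ff_star_pow (R : realType) (G : groupType) (N : normalSubgroup G)
    (f : G -> R[i]) k : Lp 1 f -> push (N := N) (ff_star_pow f k) = ff_star_pow (push (N := N) f) k.
Proof.
move=> sf; have sp := ff_star_pow_Lp1 _ sf.
elim: k => [|k IH] /=; first exact: push_dirac1.
rewrite (push_convol N (convol_Lp1 (sp k) sf) (l1_star_Lp1 sf)) (push_convol N (sp k) sf).
by rewrite (push_star N sf) IH.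
Qed.

(** The point is the order of quantifiers: [b] and [d] depend only on the bounds for the l1-norms,
    hence serve for a group and all its quotients at once. *)
Lemma uniform_log_approx (R : realType) (beta gamma : R) : 0 < beta -> 0 < gamma ->
  exists (b d : R), 0 <= d < 1 /\
  forall (G : groupType) (f h : L1 R G), (l1norm f <= beta%:E)%E -> (l1norm h <= gamma%:E)%E ->
    convol f h = @dirac1 R G -> forall n v,
    l2norm (poly_op (log_poly b n) (rho_rho_adj f) v - vN_log (rho_rho_adj f) v) <=
    d / (1 - d) * d ^+ n * l2norm v.
Proof.
move=> be0 ga0.
(* [a |v|^2] will bound [<A v, v>] from below and [M] the norm of [A] from above; the summand [a] in
   [M] ensures [a <= M]. *)
pose a : R := (2 * gamma) ^- 2; pose M := 4 * beta ^+ 2 + a.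
have a0 : 0 < a by rewrite invr_gt0 exprn_gt0// mulr_gt0.
have M0 : 0 < M by rewrite addr_gt0// mulr_gt0// exprn_gt0.
have aM : a <= M by rewrite lerDr mulr_ge0// exprn_ge0// ltW.
pose x := (a / M) ^+ 2.
have x0 : 0 < x by rewrite exprn_gt0// divr_gt0.
have x1 : x <= 1.
  by rewrite exprn_ile1// ?divr_ge0 ?(ltW a0) ?(ltW M0)// ler_pdivrMr// mul1r.
(* This [b] minimises [1 - 2 a / b + M^2 / b^2], with minimum [1 - x], and [d^2 >= 1 - x]. *)
pose b := M ^+ 2 / a; pose d := 1 - x / 2.
have b0 : 0 < b by rewrite divr_gt0// exprn_gt0.
have d01 : 0 <= d < 1 by rewrite /d; lra.
exists b, d; split=> // G f h fb hg fh n v.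
set A := rho_rho_adj f.
have Asym u w : rinner (A u) w = rinner u (A w).
  by rewrite rinner_rho_rho_adj rinnerC -rinner_rho_rho_adj rinnerC.
apply: vN_log_approx => // {}v.
have adj_le u : l2norm (vN_adj (rho f) u) <= 2 * beta * l2norm u.
  exact: (l2norm_convol (L1P f) be0 fb (vN_adj_rho f u)).
have A_le u : l2norm (A u) <= M * l2norm u.
  apply: (@le_trans _ _ (2 * beta * l2norm (vN_adj (rho f) u))).
    apply: (l2norm_convol (l1_star_Lp1 (L1P f)) be0) => //.
    by rewrite l1norm_star.
  apply: (@le_trans _ _ (2 * beta * (2 * beta * l2norm u))).
    by rewrite ler_wpM2l// mulr_ge0// ltW.
  rewrite mulrA ler_wpM2r ?l2norm_ge0// /M.
  by rewrite (_ : 2 * beta * (2 * beta) = 4 * beta ^+ 2) ?lerDl ?(ltW a0)//; ring.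
(* The inverse [h] recovers [u] from [u f], since [(u f) h = u]. *)
have adj_ge u : l2norm u <= 2 * gamma * l2norm (vN_adj (rho f) u).
  apply: (l2norm_convol (L1P h) ga0 hg).
  by rewrite vN_adj_rho convolA ?fh ?convol1//; [exact: L2P|exact: L1P|exact: L1P].
have A_ge : a * l2norm v ^+ 2 <= rinner v (A v).
  rewrite rinnerC rinner_rho_rho_adj -l2norm_sqr /a mulrC ler_pdivrMr ?exprn_gt0 ?mulr_gt0//.
  rewrite mulrC -exprMn.
  by rewrite ler_pXn2r ?nnegrE ?mulr_ge0 ?l2norm_ge0 ?(ltW ga0).
have d0 : 0 <= d by case/andP: d01.
rewrite -(@ler_pXn2r _ 2)// ?nnegrE ?mulr_ge0 ?l2norm_ge0// exprMn.
rewrite /one_minus poly_opD poly_op1 poly_opN poly_opZ poly_opX.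
rewrite [leLHS]l2norm_sqrB rinnerZr l2normZr exprMn real_normK ?num_real//.
have h1 : l2norm (A v) ^+ 2 <= M ^+ 2 * l2norm v ^+ 2.
  by rewrite -exprMn ler_pXn2r ?nnegrE ?mulr_ge0 ?l2norm_ge0 ?(ltW M0).
have ib0 : 0 <= b^-1 by rewrite invr_ge0 ltW.
have h2 := ler_wpM2l ib0 A_ge.
have h3 := ler_wpM2l (sqr_ge0 b^-1) h1.
have e1 : b^-1 * (a * l2norm v ^+ 2) = x * l2norm v ^+ 2.
  by rewrite /b /x; field; rewrite !gt_eqF.
have e2 : b^-1 ^+ 2 * (M ^+ 2 * l2norm v ^+ 2) = x * l2norm v ^+ 2.
  by rewrite /b /x; field; rewrite !gt_eqF.
have e3 : d ^+ 2 * l2norm v ^+ 2 = l2norm v ^+ 2 - x * l2norm v ^+ 2 + (x / 2) ^+ 2 * l2norm v ^+ 2.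
  by rewrite /d; field.
have e4 : 0 <= (x / 2) ^+ 2 * l2norm v ^+ 2 by rewrite mulr_ge0 ?sqr_ge0.
by move: h2 h3; rewrite e1 e2 e3; lra.
Qed.

(** A three-term estimate: the traces of the logarithms are replaced by those of a fixed polynomial,
    with an error uniform in [n], and the latter converge by [push1_cvg]. *)
Lemma log_trace_cvg (R : realType) (G : groupType) (Gn : nat -> normalSubgroup G)
    (f : L1 R G) : tends_to_trivial Gn -> L1_unit f ->
  complex.Re (vN_tr (vN_log (rho_rho_adj (pushL1 (Gn n) f)))) @[n --> \oo] -->
  complex.Re (vN_tr (vN_log (rho_rho_adj f))).
Proof.
move=> Gn1 [h [fh _]].
have [B B0 fB] := Lp1_bounded (L1P f); have [C C0 hC] := Lp1_bounded (L1P h).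
(* These bounds are positive and allow for the doubling of l1-norms in the quotients. *)
have be0 : 0 < 2 * B + 1 by rewrite ltr_wpDl// mulr_ge0.
have ga0 : 0 < 2 * C + 1 by rewrite ltr_wpDl// mulr_ge0.
have [b [d [d01 approx]]] := uniform_log_approx be0 ga0.
pose T n (K : groupType) (g : L1 R K) :=
  rinner (poly_op (log_poly b n) (rho_rho_adj g) (e1 R K)) (e1 R K).
have tr_approx (K : groupType) (g k : L1 R K) n :
    (l1norm g <= (2 * B + 1)%:E)%E -> (l1norm k <= (2 * C + 1)%:E)%E ->
    convol g k = @dirac1 R K ->
    `|T n K g - complex.Re (vN_tr (vN_log (rho_rho_adj g)))| <= d / (1 - d) * d ^+ n.
  move=> gB kC gk; rewrite /vN_tr -/(rinner _ _) /T -rinnerNl -rinnerDl.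
  have := approx K g k gB kC gk n (e1 R K); rewrite l2norm_e1 mulr1 => happ.
  rewrite ler_norml; apply/andP; split.
    rewrite lerNl -rinnerNl; apply: le_trans (rinner_le _ _) _.
    by rewrite l2norm_e1 mulr1 l2normN.
  by apply: le_trans (rinner_le _ _) _; rewrite l2norm_e1 mulr1.
have T_cvg m : T m (quot (Gn n)) (pushL1 (Gn n) f) @[n --> \oo] --> T m G f.
  rewrite /T trace_poly_op.
  under eq_fun do rewrite trace_poly_op.
  apply: cvg_big => [|i _]; first exact: add_continuous.
  apply: cvgM; first exact: cvg_cst.
  have E n : complex.Re (push (N := Gn n) (ff_star_pow f i) 1%g) =
      complex.Re (ff_star_pow (pushL1 (Gn n) f) i 1%g).
    by rewrite (push_ff_star_pow _ _ (L1P f)).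
  by under eq_fun do rewrite -E; exact: push1_cvg Gn1 (ff_star_pow_Lp1 i (L1P f)).
apply/cvgrPdist_lt => e e0.
have e3 : 0 < e / 3 by rewrite divr_gt0.
(* One polynomial index [N] serves for [G] and for every quotient; only afterwards is [n] taken
   large. *)
have [N hN] := geometric_small (d / (1 - d)) d01 e3.
have /cvgrPdist_lt /(_ _ e3) := T_cvg N; apply: filterS => n hn.
have le2 (g : L1 R G) D : 0 <= D -> (l1norm g <= D%:E)%E -> (l1norm g <= (2 * D + 1)%:E)%E.
  by move=> D0 /le_trans; apply; rewrite lee_fin; lra.
have h1 := tr_approx G f h N (le2 _ _ B0 fB) (le2 _ _ C0 hC) fh.
have push_le (g : L1 R G) D : (l1norm g <= D%:E)%E ->
    (l1norm (pushL1 (Gn n) g) <= (2 * D + 1)%:E)%E.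
  move=> gD; apply: le_trans (l1norm_push (Gn n) (L1P g)) _.
  apply: (@le_trans _ _ (2%:E * D%:E)%E); first by rewrite lee_wpmul2l// lee_fin.
  by rewrite -EFinM lee_fin lerDl.
have pfh : convol (pushL1 (Gn n) f) (pushL1 (Gn n) h) = @dirac1 R (quot (Gn n)).
  by rewrite -[LHS]/(convol (push f) (push h)) -push_convol ?fh ?push_dirac1//; exact: L1P.
have h2 := tr_approx _ (pushL1 (Gn n) f) (pushL1 (Gn n) h) N (push_le _ _ fB) (push_le _ _ hC) pfh.
move: h1 h2 hn (hN N (leqnn N)); rewrite !ltr_norml !ler_norml.
move=> /andP[? ?] /andP[? ?] /andP[? ?] ?.
by apply/andP; split; lra.
Qed.

Theorem theorem6p1 (R : realType) (G : groupType)
    (Gn : nat -> normalSubgroup G)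
    (countable_G : countable [set: G])
    (resfin_G : residually_finite G)
    (finite_index_Gn : forall n : nat, (1 <= n)%N -> finite_index (Gn n))
    (lim_Gn : tends_to_trivial Gn)
    (f : L1 R G) (unit_f : L1_unit f) :
  vN_det (rho (pushL1 (Gn n) f)) @[n --> \oo] --> vN_det (rho f).
Proof.
apply: continuous_cvg; first exact: continuous_expR.
by apply: cvgM; [exact: cvg_cst|exact: log_trace_cvg].
Qed.
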